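(* Let $(\xi_{ij})_{i,j\ge 1}$ be an infinite array of independent identically distributed Bernoulli random variables on a common probability space, each taking the values $0$ and $1$ with probability $1/2$. For each $n\ge 1$ let $M_n=(\xi_{ij})_{1\le i,j\le n}$, let $X_n=\operatorname{per}(M_n)$ be the permanent of $M_n$, and let $Y_n=\log X_n$. Then $$\mathbf{P}\left[\limsup_{n\to\infty}\frac{Y_n-\log\frac{n!}{2^n}}{\sqrt{2\log\log n}}=1\right]=1.$$
   Context: All logarithms are natural. The matrix is non-Hermitian: all entries $\xi_{ij}$, $i,j\ge1$, are independent, with no symmetry imposed. The matrices $M_n$ are nested: $M_n$ is the principal minor formed by the first $n$ rows and columns of the single infinite random matrix $(\xi_{ij})_{i,j\ge 1}$. The permanent of an $n\times n$ matrix $(a_{ij})$ is $\sum_{\pi\in S_n}\prod_{i=1}^n a_{i\pi(i)}$. By convention $\log 0=-\infty$; the ratio is considered for $n\ge 3$, so that $\log\log n>0$. *)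

(* Defs.v *)
From mathcomp Require Import all_boot all_order all_algebra perm.
From mathcomp Require Import finmap.
From mathcomp Require Import all_classical all_reals all_analysis.
Import Order.TTheory GRing.Theory Num.Theory.

Set Implicit Arguments.
Unset Strict Implicit.
Unset Printing Implicit Defensive.

Local Open Scope classical_set_scope.
Local Open Scope ring_scope.

Definition permanent (R : comPzRingType) (n : nat) (A : 'M[R]_n) : R :=
  \sum_(s : 'S_n) \prod_(i < n) A i (s i).

Definition mutually_independent d (T : measurableType d) (R : realType)
    (P : probability T R) (I : choiceType) (X : I -> {RV P >-> R}) : Prop :=
  forall (F : {fset I}) (B : I -> set R),
    (forall i, i \in F -> measurable (B i)) ->
    P (\bigcap_(i in [set` F]) (X i @^-1` B i)) =
    (\prod_(i <- F) P (X i @^-1` B i))%E.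

Section random_minors.
Context d (T : measurableType d) (R : realType) (P : probability T R).
(* Indices start at 0: [xi i j] is the entry in row i + 1 and column j + 1. *)
Variable xi : nat -> nat -> {RV P >-> R}.

Definition minor_mx (n : nat) (w : T) : 'M[R]_n :=
  \matrix_(i < n, j < n) xi i j w.

Definition minor_per (n : nat) (w : T) : R := permanent (minor_mx n w).

(* [lne] sends 0 to -oo, whereas the real logarithm [ln] sends 0 to 0. *)
Definition log_minor_per (n : nat) (w : T) : \bar R := lne (minor_per n w)%:E.

(* The indices n < 3, where log (log n) is not positive, give meaningless
   values; they do not affect a limit superior. *)
Definition lil_ratio (n : nat) (w : T) : \bar R :=
  ((log_minor_per n w - (ln (n`!%:R / 2 ^+ n))%:E) /
   (Num.sqrt (2 * ln (ln n%:R)))%:E)%E.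

End random_minors.

(* Main.v *)
Require Import Defs.
From mathcomp Require Import all_boot all_order all_algebra.
From mathcomp Require Import all_classical all_reals all_analysis.
From mathcomp Require Import perm finmap measurable_realfun zify ring lra.
Import Order.TTheory GRing.Theory Num.Theory.

Set Implicit Arguments.
Unset Strict Implicit.
Unset Printing Implicit Defensive.

Local Open Scope classical_set_scope.
Local Open Scope ring_scope.

(** Write [eps_ij = 2 xi_ij - 1] for the signs, [S_n] for the sum of the signs
    of the [n * n] minor, and

      [W_n = 2 ^ n per(M_n) / n! = (1 / n!) sum_s prod_i (1 + eps_(i, s i))],
      [G_n = prod_(i, j < n) (1 + eps_ij / n)].

    The logarithm of [W_n] is the numerator of the ratio.  The product [G_n] lies
    between [exp (S_n / n - 2)] and [exp (S_n / n)], and [S_n] is a simple random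
    walk read at time [n ^ 2].  Since [log log (n ^ 2) ~ log log n], the law of the
    iterated logarithm for this walk says that [S_n / n] divided by
    [sqrt (2 log log n)] has limit superior 1.  So it is enough to show that almost surely
    [|W_n - G_n| <= 1] for all large [n]: additive errors of size 1 are invisible
    on the scale [exp (sqrt (2 log log n))], which tends to infinity.

    Closeness ([fourth_moment_bound]).  Let [B (f, g)] be the bilinear form
    [sum_A 3 ^ |A| f^(A) g^(A)] in the Fourier-Walsh coefficients.  Bonami's
    hypercontractive inequality reads [E f ^ 4 <= B (f, f) ^ 2], and [B] is
    multiplicative: on [prod (1 + a_c eps_c)] and [prod (1 + b_c eps_c)] it takes
    the value [prod (1 + 3 a_c b_c)].  As [W_n] is an average of such products and
    [G_n] is one, all the values of [B] are explicit.  [B (W_n, W_n)] is the mean of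
    [4 ^ (number of fixed points)] over the permutations, hence at most [e ^ 3];
    [B (G_n, G_n) = (1 + 3 / n ^ 2) ^ (n ^ 2) <= e ^ 3]; and
    [B (W_n, G_n) = (1 + 3 / n) ^ n >= e ^ 3 (1 - 18 / n)].  Therefore
    [E (W_n - G_n) ^ 4 = O (n ^ -2)], which is summable, and the first
    Borel-Cantelli lemma applies.

    Walk, upper half ([ae_walk_upper]).  The exponential maximal inequality
    is applied on the blocks [q ^ k <= n < q ^ (k + 1)], with [q] close to 1.

    Walk, lower half ([ae_walk_lower]).  The increments over the disjoint blocks
    from [k! ^ 2] to [(k + 1)! ^ 2] are independent; exponential tilting
    bounds below the probability that such an increment is large
    ([walk_upper_tail]), the sum of these probabilities diverges, and the second
    Borel-Cantelli lemma applies.  Factorial times make the past negligible: it is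
    eventually at least [- k k! >= - (k + 1)!], so it costs a bounded amount after
    division by [n = (k + 1)!].

    All finite computations take place on boolean sequences.  The entries are listed
    shell by shell, so that the [n * n] minor is given by the first [n ^ 2] bits, and
    the probability of an event about the first [N] bits is an average over
    the sequences of length [N] ([prob_bit_prefix]). *)

(** * Elementary bounds on exp and cosh *)

Section exp_bounds.
Variable R : realType.
Implicit Types x t u : R.

Lemma ge0_of_derive_ge0 (f df : R -> R) :
  (forall x, is_derive x 1 f (df x)) -> (forall x, 0 <= x -> 0 <= df x) ->
  0 <= f 0 -> forall x, 0 <= x -> 0 <= f x.
Proof.
move=> fdf df0 f0 x x0; apply: (le_trans f0).
apply: (@ger0_derive1_le_cc R f 0 x); rewrite ?in_itv/= ?lexx ?x0//.
- move=> y; rewrite in_itv/= => /andP[/ltW y0 _].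
  by rewrite derive1E derive_val df0.
- apply: derivable_within_continuous => y _; exact: ex_derive.
Qed.

Lemma sinh_ge x : 0 <= x -> 0 <= expR x - expR (- x) - 2 * x.
Proof.
pose f x := expR x - expR (- x) - 2 * x.
apply: (@ge0_of_derive_ge0 f (fun x => expR x + expR (- x) - 2)).
- move=> y; apply: is_derive_eq.
  rewrite /GRing.scale /=; lra.
- move=> y y0.
  have := expR_gt0 y; rewrite expRN; set e := expR y => e0.
  have -> : e + e^-1 - 2 = (e - 1) ^+ 2 / e by field; rewrite gt_eqF.
  by rewrite divr_ge0 ?sqr_ge0 ?ltW.
- by rewrite /f oppr0 subrr mulr0 subrr.
Qed.

Definition cosh x : R := (expR x + expR (- x)) / 2.

Lemma coshN x : cosh (- x) = cosh x.
Proof. by rewrite /cosh opprK addrC. Qed.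

Lemma cosh_gt0 x : 0 < cosh x.
Proof. by rewrite divr_gt0// addr_gt0 ?expR_gt0. Qed.

Lemma even_le (f g : R -> R) :
  (forall x, f (- x) = f x) -> (forall x, g (- x) = g x) ->
  (forall x, 0 <= x -> f x <= g x) -> forall x, f x <= g x.
Proof.
move=> fN gN fg x; have [/fg//|/ltW x0] := leP 0 x.
by rewrite -fN -gN fg// oppr_ge0.
Qed.

Lemma cosh_ge x : 1 + x ^+ 2 / 2 <= cosh x.
Proof.
move: x; apply: even_le; [by move=> x; rewrite sqrrN|exact: coshN|move=> x x0].
rewrite -subr_ge0; pose f y := cosh y - (1 + y ^+ 2 / 2).
apply: (@ge0_of_derive_ge0 f (fun y => (expR y - expR (- y) - 2 * y) / 2)) => //.
- move=> y; apply: is_derive_eq; rewrite /GRing.scale /=; lra.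
- by move=> y /sinh_ge; lra.
- by rewrite /f /cosh oppr0 expR0; lra.
Qed.

Lemma x_cosh_ge x : 0 <= x -> 0 <= x * (expR x + expR (- x)) - (expR x - expR (- x)).
Proof.
pose f x := x * (expR x + expR (- x)) - (expR x - expR (- x)).
apply: (@ge0_of_derive_ge0 f (fun y => y * (expR y - expR (- y)))).
- move=> y; apply: is_derive_eq; rewrite /GRing.scale /=; lra.
- by move=> y y0; have := sinh_ge y0; nra.
- by rewrite /f mul0r oppr0 !subrr.
Qed.

(** The moment generating function of a sign is subgaussian:
    [exp (- y ^ 2 / 2) cosh y] has derivative
    [exp (- y ^ 2 / 2) (sinh y - y cosh y) <= 0] for [y >= 0]. *)
Lemma cosh_le x : cosh x <= expR (x ^+ 2 / 2).
Proof.
move: x; apply: even_le; [exact: coshN|by move=> x; rewrite sqrrN|move=> x x0].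
pose f y := 1 - expR (- (y ^+ 2 / 2)) * cosh y.
have : 0 <= f x.
  apply: (@ge0_of_derive_ge0 f (fun y => expR (- (y ^+ 2 / 2)) *
    ((y * (expR y + expR (- y)) - (expR y - expR (- y))) / 2))) => //.
  - move=> y; apply: is_derive_eq; rewrite /GRing.scale /= /cosh; lra.
  - by move=> y /x_cosh_ge y0; rewrite mulr_ge0 ?expR_ge0 ?divr_ge0.
  - by rewrite /f /cosh expr0n/= mul0r oppr0 expR0; lra.
by rewrite /f expRN subr_ge0 mulrC ler_pdivrMr ?expR_gt0// mul1r.
Qed.

(** With [u = x / (1 + x)], the bound [1 - u <= exp (- u)] inverts to
    [exp u <= 1 + x], and [u >= x - 2 x ^ 2] as soon as [x >= - 1 / 2]. *)
Lemma expR_le_1Dx x : - 2^-1 <= x -> expR (x - 2 * x ^+ 2) <= 1 + x.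
Proof.
move=> hx; have x1 : 0 < 1 + x by lra.
have h : expR (x / (1 + x)) <= 1 + x.
  rewrite -[leRHS]invrK -[leLHS]invrK lef_pV2 ?posrE ?invr_gt0 ?expR_gt0//.
  rewrite -expRN; apply: le_trans (expR_ge1Dx _).
  by rewrite le_eqVlt; apply/orP; left; apply/eqP; field; rewrite gt_eqF.
apply: le_trans h; rewrite ler_expR ler_pdivlMr//.
have -> : (x - 2 * x ^+ 2) * (1 + x) = x - x ^+ 2 * (1 + 2 * x) by ring.
by rewrite gerBl mulr_ge0 ?sqr_ge0//; lra.
Qed.

Lemma cosh_ge_expR x : expR (x ^+ 2 / 2 - x ^+ 4 / 2) <= cosh x.
Proof.
apply: le_trans (cosh_ge _).
have := sqr_ge0 x => x2.
have -> : x ^+ 2 / 2 - x ^+ 4 / 2 = x ^+ 2 / 2 - 2 * (x ^+ 2 / 2) ^+ 2 by field.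
by apply: expR_le_1Dx; lra.
Qed.

End exp_bounds.

(** * Expectation and hypercontractivity on the discrete cube *)

Section cube.
Variable R : realType.
Implicit Types (f g : seq bool -> R) (a b : nat -> R) (s : seq bool).

(** Averaged one coordinate at a time, because the proofs below are inductions on the
    number of coordinates. *)
Fixpoint cubeE (N : nat) f : R :=
  if N is M.+1 then
    (cubeE M (fun s => f (true :: s)) + cubeE M (fun s => f (false :: s))) / 2
  else f [::].

Lemma cubeE_le N f g : (forall s, size s = N -> f s <= g s) ->
  cubeE N f <= cubeE N g.
Proof.
elim: N f g => [|N IH] f g fg /=; first exact: fg.
by rewrite ler_pM2r ?invr_gt0// lerD// IH// => s sN; apply: fg; rewrite /= sN.
Qed.

Lemma eq_cubeE N f g : (forall s, size s = N -> f s = g s) ->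
  cubeE N f = cubeE N g.
Proof. by move=> fg; apply/le_anti/andP; split; apply: cubeE_le => s /fg ->. Qed.

Lemma cubeE_cst N c : cubeE N (fun=> c) = c.
Proof. by elim: N => //= N ->; field. Qed.

Lemma cubeED N f g : cubeE N (fun s => f s + g s) = cubeE N f + cubeE N g.
Proof. by elim: N f g => //= N IH f g; rewrite !IH; field. Qed.

Lemma cubeEZ N c f : cubeE N (fun s => c * f s) = c * cubeE N f.
Proof. by elim: N f => //= N IH f; rewrite !IH; field. Qed.

Lemma cubeEB N f g : cubeE N (fun s => f s - g s) = cubeE N f - cubeE N g.
Proof.
rewrite -[X in _ - X]mul1r -mulNr -cubeEZ -cubeED.
by apply: eq_cubeE => s _; rewrite mulN1r.
Qed.

Lemma cubeE_ge0 N f : (forall s, size s = N -> 0 <= f s) -> 0 <= cubeE N f.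
Proof. by move=> f0; rewrite -(cubeE_cst N 0); apply: cubeE_le. Qed.

(** Functions of disjoint groups of coordinates are independent. *)
Lemma cubeE_cat M N f g :
  cubeE (M + N) (fun s => f (take M s) * g (drop M s)) = cubeE M f * cubeE N g.
Proof.
elim: M f => [|M IH] f /=.
  by rewrite add0n -cubeEZ; apply: eq_cubeE => s _; rewrite take0 drop0.
by rewrite (IH (fun s => f (true :: s))) (IH (fun s => f (false :: s))); field.
Qed.

Lemma cubeE_ind_le1 N (Q : pred (seq bool)) : cubeE N (fun s => (Q s)%:R) <= 1.
Proof. by rewrite -[leRHS](cubeE_cst N); apply: cubeE_le => s _; case: (Q s). Qed.

Lemma markov_cubeE N f (c : R) (Q : pred (seq bool)) : 0 < c ->
  (forall s, size s = N -> 0 <= f s) ->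
  (forall s, size s = N -> Q s -> c <= f s) ->
  cubeE N (fun s => (Q s)%:R) <= cubeE N f / c.
Proof.
move=> c0 f0 Qf; rewrite mulrC -cubeEZ; apply: cubeE_le => s sN.
rewrite mulrC ler_pdivlMr//; case: (boolP (Q s)) => [Qs|_].
  by rewrite mul1r Qf.
by rewrite mul0r f0.
Qed.

(** The induction step of the Cauchy-Schwarz inequality: it is the two-term
    case, after [2 |x y| <= 2 sqrt ((p t) (r q)) <= p t + r q]. *)
Lemma cauchy_step (x y p q r t : R) : 0 <= p -> 0 <= q -> 0 <= r -> 0 <= t ->
  x ^+ 2 <= p * q -> y ^+ 2 <= r * t -> (x + y) ^+ 2 <= (p + r) * (q + t).
Proof.
move=> p0 q0 r0 t0 xpq yrt.
have h : 2 * (x * y) <= p * t + r * q.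
  apply: le_trans (ler_norm _) _; rewrite -ler_sqr ?nnegrE ?addr_ge0 ?mulr_ge0//.
  rewrite real_normK ?num_real//.
  have h1 : x ^+ 2 * y ^+ 2 <= (p * q) * (r * t) by rewrite ler_pM ?sqr_ge0.
  have := sqr_ge0 (p * t - r * q); nra.
nra.
Qed.

Lemma cauchy_schwarz_cubeE N f g :
  (cubeE N (fun s => f s * g s)) ^+ 2 <=
  cubeE N (fun s => f s ^+ 2) * cubeE N (fun s => g s ^+ 2).
Proof.
elim: N f g => [|N IH] f g /=; first by rewrite exprMn.
have E0 h : 0 <= cubeE N (fun s => h s ^+ 2) by apply: cubeE_ge0 => *; exact: sqr_ge0.
have := cauchy_step (E0 _) (E0 _) (E0 _) (E0 _)
  (IH (fun s => f (true :: s)) (fun s => g (true :: s)))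
  (IH (fun s => f (false :: s)) (fun s => g (false :: s))).
lra.
Qed.

(** The form [sum_A 3 ^ |A| f^(A) g^(A)] in the Fourier-Walsh coefficients, defined
    without them: writing [f = f0 + eps f1] and [g = g0 + eps g1] in the first
    coordinate [eps], it is the form of [f0, g0] plus three times that of [f1, g1]. *)
Fixpoint noiseB (N : nat) f g : R :=
  if N is M.+1 then
    noiseB M (fun s => (f (true :: s) + f (false :: s)) / 2)
             (fun s => (g (true :: s) + g (false :: s)) / 2) +
    3 * noiseB M (fun s => (f (true :: s) - f (false :: s)) / 2)
                 (fun s => (g (true :: s) - g (false :: s)) / 2)
  else f [::] * g [::].

Lemma eq_noiseB N f f' g g' : (forall s, size s = N -> f s = f' s) ->
  (forall s, size s = N -> g s = g' s) -> noiseB N f g = noiseB N f' g'.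
Proof.
elim: N f f' g g' => [|N IH] f f' g g' ff gg /=; first by rewrite ff// gg.
by congr (_ + 3 * _); apply: IH => s sN; rewrite ?ff ?gg//= sN.
Qed.

Lemma noiseBC N f g : noiseB N f g = noiseB N g f.
Proof.
elim: N f g => [|N IH] f g /=; first by rewrite mulrC.
by rewrite IH [X in 3 * X]IH.
Qed.

Lemma noiseBDl N f f' g : noiseB N (fun s => f s + f' s) g =
  noiseB N f g + noiseB N f' g.
Proof.
elim: N f f' g => [|N IH] f f' g /=; first by rewrite mulrDl.
set P := LHS; rewrite [RHS](_ : _ = (noiseB N
    (fun s => (f (true :: s) + f (false :: s)) / 2)
    (fun s => (g (true :: s) + g (false :: s)) / 2) + noiseB N
    (fun s => (f' (true :: s) + f' (false :: s)) / 2)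
    (fun s => (g (true :: s) + g (false :: s)) / 2)) + 3 * (noiseB N
    (fun s => (f (true :: s) - f (false :: s)) / 2)
    (fun s => (g (true :: s) - g (false :: s)) / 2) + noiseB N
    (fun s => (f' (true :: s) - f' (false :: s)) / 2)
    (fun s => (g (true :: s) - g (false :: s)) / 2))); last by ring.
by rewrite -!IH /P; congr (_ + 3 * _); apply: eq_noiseB => s _ //; field.
Qed.

Lemma noiseBZl N c f g : noiseB N (fun s => c * f s) g = c * noiseB N f g.
Proof.
elim: N f g => [|N IH] f g /=; first by rewrite mulrA.
rewrite mulrDr mulrCA -!IH.
by congr (_ + 3 * _); apply: eq_noiseB => s _ //; field.
Qed.

Lemma noiseB_sumr N (I : Type) (r : seq I) (F : I -> seq bool -> R) g :
  noiseB N g (fun s => \sum_(i <- r) F i s) = \sum_(i <- r) noiseB N g (F i).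
Proof.
elim: r => [|i r IH].
  rewrite big_nil noiseBC (@eq_noiseB _ _ (fun=> 0 * 0) _ g)//; last first.
    by move=> s _; rewrite big_nil mulr0.
  by rewrite noiseBZl mul0r.
rewrite big_cons -IH noiseBC [in RHS]noiseBC [X in _ + X]noiseBC -noiseBDl.
by apply: eq_noiseB => s _ //; rewrite big_cons.
Qed.

Lemma noiseB_subr N f g : noiseB N (fun s => f s - g s) (fun s => f s - g s) =
  noiseB N f f - 2 * noiseB N f g + noiseB N g g.
Proof.
have subl h : noiseB N (fun s => f s - g s) h = noiseB N f h - noiseB N g h.
  rewrite -[X in _ - X]mul1r -mulNr -noiseBZl -noiseBDl.
  by apply: eq_noiseB => s _ //; rewrite mulN1r.
rewrite subl ![noiseB N _ (fun s => f s - g s)]noiseBC !subl.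
by rewrite [noiseB N g f]noiseBC; ring.
Qed.

Lemma noiseB_ge0 N f : 0 <= noiseB N f f.
Proof.
elim: N f => [|N IH] f /=; first by rewrite -expr2 sqr_ge0.
by rewrite addr_ge0 ?mulr_ge0.
Qed.

(** Bonami's inequality.  For [f = g + eps h] the odd moments of [eps] vanish, so
    [E f ^ 4 = E g ^ 4 + 6 E (g ^ 2 h ^ 2) + E h ^ 4]; by Cauchy-Schwarz and induction
    this is at most [G ^ 2 + 6 G H + H ^ 2 <= (G + 3 H) ^ 2], where [G] and [H] are
    the forms of [g] and [h]. *)
Lemma bonami N f : cubeE N (fun s => f s ^+ 4) <= noiseB N f f ^+ 2.
Proof.
elim: N f => [|N IH] f /=; first by rewrite le_eqVlt; apply/orP; left; apply/eqP; ring.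
set g := (fun s => (f (true :: s) + f (false :: s)) / 2).
set h := (fun s => (f (true :: s) - f (false :: s)) / 2).
rewrite [leLHS](_ : _ = cubeE N (fun s => g s ^+ 4) +
    6 * cubeE N (fun s => g s ^+ 2 * h s ^+ 2) + cubeE N (fun s => h s ^+ 4)).
  have Gg := IH g; have Hh := IH h.
  have G0 := noiseB_ge0 N g; have H0 := noiseB_ge0 N h.
  have cs : cubeE N (fun s => g s ^+ 2 * h s ^+ 2) <= noiseB N g g * noiseB N h h.
    rewrite -ler_sqr ?nnegrE ?mulr_ge0//; last first.
      by apply: cubeE_ge0 => s _; rewrite mulr_ge0 ?sqr_ge0.
    apply: le_trans (cauchy_schwarz_cubeE _ _ _) _; rewrite exprMn ler_pM//.
    - by apply: cubeE_ge0 => s _; rewrite sqr_ge0.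
    - by apply: cubeE_ge0 => s _; rewrite sqr_ge0.
    - by apply: le_trans Gg; apply: cubeE_le => s _; rewrite -exprM.
    - by apply: le_trans Hh; apply: cubeE_le => s _; rewrite -exprM.
  by have := mulr_ge0 H0 H0; nra.
rewrite -cubeED mulrC -!cubeEZ -!cubeED.
by apply: eq_cubeE => s _; rewrite /g /h; field.
Qed.

Definition sgn (b : bool) : R := if b then 1 else -1.

Fixpoint prodf a s : R :=
  if s is b :: s' then (1 + a 0%N * sgn b) * prodf (fun i => a i.+1) s' else 1.

Lemma prodfE a s : prodf a s = \prod_(i < size s) (1 + a i * sgn (nth false s i)).
Proof.
elim: s a => [|b s IH] a /=; first by rewrite big_ord0.
by rewrite big_ord_recl IH.
Qed.

(** Splitting off the first coordinate, [f0 = prodf a'] and [f1 = a_0 prodf a'] with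
    [a'] the shifted sequence, so each coordinate contributes a
    factor [1 + 3 a_i b_i]. *)
Lemma noiseB_prodf N a b :
  noiseB N (prodf a) (prodf b) = \prod_(i < N) (1 + 3 * (a i * b i)).
Proof.
elim: N a b => [|N IH] a b; first by rewrite big_ord0 /= mulr1.
pose a' i := a i.+1; pose b' i := b i.+1.
rewrite big_ord_recl -[X in _ * X](IH a' b') [LHS]/=.
rewrite (@eq_noiseB _ _ (prodf a') _ (prodf b')); [|by move=> s _ /=; field..].
rewrite [X in 3 * X](@eq_noiseB _ _ (fun s => a 0%N * prodf a' s) _
  (fun s => b 0%N * prodf b' s)); [|by move=> s _ /=; field..].
by rewrite noiseBZl [X in 3 * (_ * X)]noiseBC noiseBZl noiseBC; ring.
Qed.

End cube.

(** * Tail bounds for the simple random walk *)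

Section walk.
Variable R : realType.
Implicit Types (s : seq bool) (l t b : R).

Definition walk s : R := \sum_(x <- s) sgn R x.

Lemma walk_cons x s : walk (x :: s) = sgn R x + walk s.
Proof. exact: big_cons. Qed.

Lemma walk_cat s s' : walk (s ++ s') = walk s + walk s'.
Proof. exact: big_cat. Qed.

Lemma cubeE_expR_walk N t : cubeE N (fun s => expR (t * walk s)) = cosh t ^+ N.
Proof.
elim: N => [|N IH] /=; first by rewrite /walk big_nil mulr0 expR0.
have E x : cubeE N (fun s => expR (t * walk (x :: s))) =
    expR (t * sgn R x) * cosh t ^+ N.
  rewrite -IH -cubeEZ; apply: eq_cubeE => s _.
  by rewrite walk_cons mulrDr expRD.
by rewrite !E /sgn mulr1 mulrN1 exprS /cosh; field.
Qed.

(** The walk with steps [s] reaches the level [l] at some time, time 0 included. *)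
Fixpoint crosses l s : bool :=
  (l <= 0) || (if s is x :: s' then crosses (l - sgn R x) s' else false).

Lemma crosses_take l k s : l <= walk (take k s) -> crosses l s.
Proof.
elim: s l k => [|x s IH] l [|k] /=; rewrite ?take0 /walk ?big_nil => h.
- by rewrite h.
- by rewrite h.
- by rewrite h.
- apply/orP; right; apply: (IH _ k).
  by rewrite lerBlDl; rewrite big_cons in h.
Qed.

(** An exponential maximal inequality by first-step analysis: the right-hand side is
    at least 1 for [l <= 0], and otherwise it is the average of its
    values at [l - 1] and [l + 1] with one step less. *)
Lemma crosses_mgf N l t : 0 <= t ->
  cubeE N (fun s => (crosses l s)%:R) <= expR (- (t * l)) * cosh t ^+ N.
Proof.
move=> t0; elim: N l => [|N IH] l; have [l0|l0] := leP l 0.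
- by rewrite /= l0 expr0 mulr1 -[leLHS]expR0 ler_expR oppr_ge0 mulr_ge0_le0.
- by rewrite /= orbF (lt_geF l0) expr0 mulr1 expR_ge0.
- apply: le_trans (cubeE_ind_le1 R _ _) _; rewrite -[leLHS]mul1r.
  apply: ler_pM => //.
    by rewrite -[leLHS]expR0 ler_expR oppr_ge0 mulr_ge0_le0.
  apply: exprn_ege1; apply: le_trans (cosh_ge t).
  by rewrite lerDl divr_ge0 ?sqr_ge0.
- rewrite /= (lt_geF l0) /=.
  apply: (@le_trans _ _ ((expR (- (t * (l - 1))) * cosh t ^+ N +
                          expR (- (t * (l - -1))) * cosh t ^+ N) / 2)).
    by rewrite ler_pM2r ?invr_gt0// lerD// IH.
  rewrite [cosh t ^+ N.+1]exprS; set c := cosh t ^+ N; rewrite /cosh.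
  have -> : - (t * (l - 1)) = - (t * l) + t by ring.
  have -> : - (t * (l - -1)) = - (t * l) + - t by ring.
  by rewrite !expRD le_eqVlt; apply/orP; left; apply/eqP; field.
Qed.

(** The previous bound at the optimal parameter [t = l / N]. *)
Lemma maximal_walk N l : 0 <= l -> (0 < N)%N ->
  cubeE N (fun s => (crosses l s)%:R) <= expR (- (l ^+ 2 / (2 * N%:R))).
Proof.
move=> l0 N0; have N0' : 0 < N%:R :> R by rewrite ltr0n.
apply: le_trans (@crosses_mgf N l (l / N%:R) _) _; first by rewrite divr_ge0// ltW.
apply: (@le_trans _ _ (expR (- (l / N%:R * l)) * expR ((l / N%:R) ^+ 2 / 2) ^+ N)).
  rewrite ler_pM2l ?expR_gt0// lerXn2r ?nnegrE ?expR_ge0 ?cosh_le//.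
  exact/ltW/cosh_gt0.
rewrite -expRM_natl -expRD ler_expR le_eqVlt; apply/orP; left; apply/eqP.
by field; rewrite gt_eqF.
Qed.

Lemma walk_lower_tail N l : 0 <= l -> (0 < N)%N ->
  cubeE N (fun s => (walk s <= - l)%R%:R) <= expR (- (l ^+ 2 / (2 * N%:R))).
Proof.
move=> l0 N0; have N0' : 0 < N%:R :> R by rewrite ltr0n.
have t0 : 0 <= l / N%:R by rewrite divr_ge0// ltW.
set t := l / N%:R in t0.
apply: le_trans (@markov_cubeE _ _ (fun s => expR (- t * walk s)) (expR (t * l)) _ _ _ _) _.
- exact: expR_gt0.
- by move=> s _; exact: expR_ge0.
- by move=> s _ h; rewrite ler_expR mulNr -mulrN ler_wpM2l// lerNr.
rewrite cubeE_expR_walk coshN -expRN.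
apply: (@le_trans _ _ (expR (t ^+ 2 / 2) ^+ N * expR (- (t * l)))).
  rewrite ler_pM2r ?expR_gt0// lerXn2r ?nnegrE ?expR_ge0 ?cosh_le//.
  exact/ltW/cosh_gt0.
rewrite -expRM_natl -expRD ler_expR le_eqVlt; apply/orP; left; apply/eqP.
by rewrite /t; field; rewrite gt_eqF.
Qed.

(** Exponential tilting.  For [t = b / sqrt m] the weight [exp (t S)] concentrates in
    the window [sqrt m (b - 2) <= S <= sqrt m (b + 2)]: by Chernoff bounds with the shifted
    parameters [t -+ u], [u = 2 / sqrt m], each side of the window carries at most
    [exp (- 2) <= 1 / 4] of [exp (b ^ 2 / 2)], whereas the total weight
    [cosh t ^ m] is at least [7 / 8] of it.  On the window the weight is
    at most [exp (b ^ 2 + 2 b)], which turns the remaining [3 / 8 >= 1 / 4] into a lower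
    bound for the probability. *)
Lemma walk_upper_tail m b : 0 <= b -> (0 < m)%N -> 4 * b ^+ 4 <= m%:R ->
  4^-1 * expR (- (b ^+ 2 / 2 + 2 * b)) <=
  cubeE m (fun s => (Num.sqrt m%:R * (b - 2) <= walk s)%R%:R).
Proof.
move=> b0 m0 bm; have m0' : 0 < m%:R :> R by rewrite ltr0n.
set q := Num.sqrt m%:R.
have q0 : 0 < q by rewrite sqrtr_gt0.
have qm : m%:R = q ^+ 2 by rewrite sqr_sqrtr// ltW.
pose t := b / q; pose u := 2 / q.
have t0 : 0 <= t by rewrite divr_ge0// ltW.
have u0 : 0 < u by rewrite divr_gt0.
(* [F] is at most the indicator of [sqrt m * (b - 2) <= S]: outside of the window one of
   the two subtracted terms exceeds [exp (t S)], and inside it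
   [exp (t S - t sqrt m (b + 2)) <= 1]. *)
pose F s := expR (- (t * (q * (b + 2)))) * (expR (t * walk s) -
   (expR (u * (q * (b - 2))) * expR ((t - u) * walk s) +
    expR (- (u * (q * (b + 2)))) * expR ((t + u) * walk s))).
apply: (@le_trans _ _ (cubeE m F)); last first.
  apply: cubeE_le => s _; rewrite /F; set S := walk s.
  rewrite -!expRD.
  have -> : u * (q * (b - 2)) + (t - u) * S = t * S + u * (q * (b - 2) - S) by ring.
  have -> : - (u * (q * (b + 2))) + (t + u) * S = t * S + u * (S - q * (b + 2)) by ring.
  rewrite !expRD -mulrDr -{1}[expR (t * S)]mulr1 -mulrBr mulrA -expRD.
  have P1 := expR_gt0 (- (t * (q * (b + 2))) + t * S).
  have P2 := expR_gt0 (u * (q * (b - 2) - S)).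
  have P3 := expR_gt0 (u * (S - q * (b + 2))).
  have [h1|h1] := leP (q * (b - 2)) S; last first.
    have : 1 <= expR (u * (q * (b - 2) - S)).
      by rewrite -[leLHS]expR0 ler_expR mulr_ge0 ?subr_ge0 ?ltW.
    by move=> h; apply: mulr_ge0_le0; [exact: ltW|lra].
  have [h2|h2] := leP S (q * (b + 2)); last first.
    have : 1 <= expR (u * (S - q * (b + 2))).
      by rewrite -[leLHS]expR0 ler_expR mulr_ge0 ?subr_ge0 ?ltW.
    move=> h; apply: (@le_trans _ _ 0); last by [].
    by apply: mulr_ge0_le0; [exact: ltW|lra].
  have : expR (- (t * (q * (b + 2))) + t * S) <= 1.
    rewrite -[leRHS]expR0 ler_expR; nra.
  by rewrite /=; nra.
rewrite /F cubeEZ cubeEB cubeED !cubeEZ !cubeE_expR_walk.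
have cm x : cosh x ^+ m <= expR (m%:R * (x ^+ 2 / 2)).
  rewrite expRM_natl lerXn2r ?nnegrE ?expR_ge0 ?cosh_le//; exact/ltW/cosh_gt0.
have c1 : expR (m%:R * (t ^+ 2 / 2 - t ^+ 4 / 2)) <= cosh t ^+ m.
  by rewrite expRM_natl lerXn2r ?nnegrE ?expR_ge0 ?cosh_ge_expR//; exact/ltW/cosh_gt0.
have {}c1 : 7 / 8 * expR (b ^+ 2 / 2) <= cosh t ^+ m.
  apply: le_trans c1.
  have -> : m%:R * (t ^+ 2 / 2 - t ^+ 4 / 2) = - (b ^+ 4 / (2 * m%:R)) + b ^+ 2 / 2.
    by rewrite /t qm; field; rewrite gt_eqF.
  rewrite expRD ler_pM2r ?expR_gt0//; apply: le_trans (expR_ge1Dx _).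
  suff : b ^+ 4 / (2 * m%:R) <= 8^-1 by lra.
  by rewrite ler_pdivrMr ?mulr_gt0//; lra.
have e2 : expR (- 2) <= 4^-1 :> R.
  have -> : - 2 = - 1 + - 1 :> R by ring.
  have := expR_ge1Dx (1 : R) => h1.
  have h2 : expR (- 1) <= 2^-1 :> R by rewrite expRN lef_pV2 ?posrE ?expR_gt0//; lra.
  by have := expR_ge0 (- 1 : R); rewrite expRD; nra.
have c2 : expR (u * (q * (b - 2))) * cosh (t - u) ^+ m <= 4^-1 * expR (b ^+ 2 / 2).
  apply: (@le_trans _ _ (expR (u * (q * (b - 2))) * expR (m%:R * ((t - u) ^+ 2 / 2)))).
    by rewrite ler_pM2l ?expR_gt0 ?cm.
  rewrite -expRD [X in expR X](_ : _ = - 2 + b ^+ 2 / 2).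
    by rewrite expRD ler_pM2r ?expR_gt0.
  by rewrite /t /u qm; field; rewrite gt_eqF.
have c3 : expR (- (u * (q * (b + 2)))) * cosh (t + u) ^+ m <= 4^-1 * expR (b ^+ 2 / 2).
  apply: (@le_trans _ _ (expR (- (u * (q * (b + 2)))) * expR (m%:R * ((t + u) ^+ 2 / 2)))).
    by rewrite ler_pM2l ?expR_gt0 ?cm.
  rewrite -expRD [X in expR X](_ : _ = - 2 + b ^+ 2 / 2).
    by rewrite expRD ler_pM2r ?expR_gt0.
  by rewrite /t /u qm; field; rewrite gt_eqF.
have -> : - (t * (q * (b + 2))) = - (b ^+ 2 / 2 + 2 * b) + - (b ^+ 2 / 2).
  by rewrite /t; field; rewrite gt_eqF.
rewrite [in leRHS]expRD -mulrA [leLHS]mulrC ler_pM2l ?expR_gt0//.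
rewrite expRN mulrC ler_pdivlMr ?expR_gt0//.
by have := expR_gt0 (b ^+ 2 / 2); lra.
Qed.

End walk.

(** * Enumerating the matrix entries by shells *)

Section cells.

(** The positions in the minor of order [n + 1] that are outside of the minor of
    order [n]. *)
Definition shell (n : nat) : seq (nat * nat) :=
  [seq (n, j) | j <- iota 0 n.+1] ++ [seq (i, n) | i <- iota 0 n].

Fixpoint cells (n : nat) : seq (nat * nat) :=
  if n is m.+1 then cells m ++ shell m else [::].

Lemma cellsS n : cells n.+1 = cells n ++ shell n.
Proof. by []. Qed.

(** The position number [k] in the enumeration of all positions by shells.  The default
    value of [nth] is never used, as [cells k.+1] has [(k + 1) ^ 2 > k] elements. *)
Definition cell (k : nat) : nat * nat := nth (0%N, 0%N) (cells k.+1) k.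

Lemma size_cells n : size (cells n) = (n * n)%N.
Proof.
by elim: n => //= n IH; rewrite !size_cat IH !size_map !size_iota; lia.
Qed.

Lemma mem_shell n i j : ((i, j) \in shell n) = (maxn i j == n).
Proof.
rewrite mem_cat; apply/idP/idP.
  by case/orP => /mapP[k]; rewrite mem_iota add0n => /= kn [-> ->]; lia.
move=> ijn; have [ni|ni] := eqVneq i n.
  by apply/orP; left; apply/mapP; exists j; rewrite ?mem_iota ?ni//; lia.
have jn : j = n by lia.
by apply/orP; right; apply/mapP; exists i; rewrite ?mem_iota ?jn//; lia.
Qed.

Lemma mem_cells n i j : ((i, j) \in cells n) = (i < n)%N && (j < n)%N.
Proof.
elim: n => [|n IH]; first by rewrite in_nil !ltn0.
by rewrite cellsS mem_cat IH mem_shell; lia.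
Qed.

Lemma cells_uniq n : uniq (cells n).
Proof.
elim: n => // n IH; rewrite cellsS cat_uniq IH andTb; apply/andP; split.
  apply/hasPn => -[i j]; rewrite mem_shell mem_cells => ijn; lia.
rewrite /shell cat_uniq !map_inj_uniq ?iota_uniq ?andbT ?andTb; last 2 first.
- by move=> ? ? [].
- by move=> ? ? [].
apply/hasPn => c /mapP[i]; rewrite mem_iota add0n => /andP[_ i_n] ->.
by apply/negP => /mapP [j _ []]; lia.
Qed.

Lemma cells_prefix m n : (m <= n)%N -> exists t, cells n = cells m ++ t.
Proof.
elim: n => [|n IH]; first by rewrite leqn0 => /eqP ->; exists [::].
rewrite leq_eqVlt => /orP[/eqP ->|]; first by exists [::]; rewrite cats0.
by rewrite ltnS cellsS => /IH[t ->]; exists (t ++ shell n); rewrite catA.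
Qed.

Lemma nth_cells n k : (k < n * n)%N -> nth (0%N, 0%N) (cells n) k = cell k.
Proof.
move=> kn; rewrite /cell; have [nk|kn'] := leqP n k.+1.
  have [t ->] := cells_prefix nk.
  by rewrite nth_cat size_cells kn.
have [t ->] := cells_prefix (ltnW kn').
by rewrite nth_cat size_cells ifT//; lia.
Qed.

Lemma cells_mkseq n : cells n = mkseq cell (n * n).
Proof.
apply: (@eq_from_nth _ (0%N, 0%N)); first by rewrite size_mkseq size_cells.
by move=> k; rewrite size_cells => kn; rewrite nth_mkseq// nth_cells.
Qed.

Lemma cell_inj : injective cell.
Proof.
move=> k l kl; pose n := (maxn k l).+1.
have kn : (k < n * n)%N by rewrite /n; nia.
have ln : (l < n * n)%N by rewrite /n; nia.
have /uniqP := cells_uniq n => /(_ (0%N, 0%N)); apply.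
- by rewrite inE size_cells.
- by rewrite inE size_cells.
- by rewrite !nth_cells.
Qed.

Lemma prod_cells (R : comPzRingType) n (F : nat * nat -> R) :
  \prod_(k < n * n) F (cell k) = \prod_(i < n) \prod_(j < n) F (i : nat, j : nat).
Proof.
have -> : \prod_(k < n * n) F (cell k) = \prod_(c <- cells n) F c.
  by rewrite cells_mkseq big_map -val_enum_ord big_map big_enum.
have -> : \prod_(i < n) \prod_(j < n) F (i : nat, j : nat) =
    \prod_(c <- [seq (i, j) | i <- iota 0 n, j <- iota 0 n]) F c.
  rewrite big_allpairs -(big_mkord xpredT (fun i => \prod_(j < n) F (i, j : nat))).
  rewrite /index_iota subn0; apply: eq_bigr => i _.
  by rewrite -(big_mkord xpredT (fun j => F (i, j))) /index_iota subn0.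
apply: perm_big; apply: uniq_perm; first exact: cells_uniq.
  by rewrite allpairs_uniq ?iota_uniq// => -[? ?] [? ?] _ _ [-> ->].
move=> [i j]; rewrite mem_cells; apply/idP/allpairsP.
  by move=> /andP[hi hj]; exists (i, j); rewrite /= !mem_iota.
by move=> [[a b]]; rewrite /= !mem_iota => -[/= ha hb [-> ->]]; rewrite ha hb.
Qed.

End cells.

(** * The normalized permanent and the exponential product *)

Section permanent_chaos.
Variable R : realType.

Lemma expR_ge_partial_sum (x : R) n : 0 <= x ->
  \sum_(k < n) x ^+ k / k`!%:R <= expR x.
Proof.
move=> x0; rewrite -(big_mkord xpredT (fun k => x ^+ k / k`!%:R)).
apply: (@nondecreasing_cvgn_le _ (series (exp_coeff x))).
  apply/nondecreasing_seqP => m.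
  by rewrite /series /= big_nat_recr//= lerDl divr_ge0 ?exprn_ge0.
exact: is_cvg_series_exp_coeff.
Qed.

(** The mean of [(1 + c) ^ (number of fixed points)] over the permutations.  Expanding the
    product over the set [A] of chosen fixed points, there are [(n - |A|)!]
    permutations fixing [A] pointwise and ['C(n, k)] sets of size [k], so that the mean
    is the partial sum of order [n] of the series of [exp c]. *)
Lemma sum_perm_fixpoints n (c : R) : 0 <= c ->
  (n`!%:R)^-1 * \sum_(s : 'S_n) \prod_(i < n) (1 + c * (s i == i)%:R) <= expR c.
Proof.
move=> c0.
have E1 (s : 'S_n) : \prod_(i < n) (1 + c * (s i == i)%:R) =
    \sum_(A : {set 'I_n}) (perm_on (~: A) s)%:R * c ^+ #|A|.
  under eq_bigr do rewrite addrC.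
  rewrite bigA_distr; apply: eq_bigr => A _.
  rewrite -big_mkcond/= big_split/= prodr_const mulrC; congr (_ * _).
  have [sA|sA] := boolP (perm_on (~: A) s).
    apply: big1 => i iA; have [//|/= si] := eqVneq (s i) i.
    by move/fintype.subsetP: sA => /(_ i); rewrite !inE => /(_ si); rewrite iA.
  move: sA => /fintype.subsetPn[i]; rewrite !inE negbK => si iA.
  by rewrite (bigD1 i)//= (negbTE si) mul0r.
under eq_bigr do rewrite E1.
rewrite exchange_big /=.
have E2 (A : {set 'I_n}) : \sum_(s : 'S_n) (perm_on (~: A) s)%:R * c ^+ #|A| =
    (n - #|A|)`!%:R * c ^+ #|A|.
  rewrite -mulr_suml -natr_sum; congr (_%:R * _).
  rewrite -big_mkcond/= sum1_card card_perm; congr (_ `!).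
  by rewrite cardsCs finset.setCK card_ord.
under eq_bigr do rewrite E2.
rewrite (partition_big (fun A : {set 'I_n} => inord #|A| : 'I_n.+1) xpredT)//=.
apply: le_trans (expR_ge_partial_sum n.+1 c0).
rewrite mulr_sumr; apply: ler_sum => k _.
rewrite (eq_bigr (fun=> (n - k)`!%:R * c ^+ k)); last first.
  move=> A /eqP <-; rewrite inordK// ltnS.
  by apply: leq_trans (max_card _) _; rewrite card_ord.
rewrite sumr_const (_ : #|_| = 'C(n, k)); last first.
  have -> : 'C(n, k) = 'C(#|'I_n|, k) by rewrite card_ord.
  rewrite -card_draws; apply: eq_card => A.
  rewrite !inE unfold_in /=; change (eqn (inord #|A| : 'I_n.+1) k = (#|A| == k)).
  rewrite inordK// ltnS.
  by apply: leq_trans (max_card _) _; rewrite card_ord.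
have kn : (k <= n)%N by rewrite -ltnS.
rewrite -(bin_fact kn) !natrM.
have f0 m : m`!%:R != 0 :> R by rewrite pnatr_eq0 -lt0n fact_gt0.
have b0 : 'C(n, k)%:R != 0 :> R by rewrite pnatr_eq0 -lt0n bin_gt0.
rewrite -mulr_natr le_eqVlt; apply/orP; left; apply/eqP; field.
by rewrite b0 !f0.
Qed.

Definition on_graph n (s : 'S_n) (c : nat * nat) : R :=
  [exists i : 'I_n, c == (i : nat, s i : nat)]%:R.

Lemma on_graphE n (s : 'S_n) (i j : 'I_n) : on_graph s (i : nat, j : nat) = (s i == j)%:R.
Proof.
rewrite /on_graph; congr (_%:R); congr nat_of_bool; apply/existsP/eqP.
  by move=> [k /eqP[/val_inj -> /val_inj ->]].
by move=> <-; exists i.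
Qed.

(** [2 ^ n per / n!] as a function of the first [n ^ 2] bits, written as an average of
    multilinear products; see [perm_chaosE]. *)
Definition perm_chaos n (s : seq bool) : R :=
  (n`!%:R)^-1 * \sum_(p : 'S_n) prodf (fun k => on_graph p (cell k)) s.

(** The product of [1 + eps / n] over the entries of the minor, which is almost
    [exp (S_n / n - 1 / 2)]. *)
Definition expo_chaos n (s : seq bool) : R := prodf (fun=> n%:R^-1) s.

Definition read_cells (x : nat * nat -> bool) (N : nat) : seq bool :=
  mkseq (fun k => x (cell k)) N.

Lemma perm_chaosE n (x : nat * nat -> bool) :
  perm_chaos n (read_cells x (n * n)) = 2 ^+ n / n`!%:R *
    permanent (\matrix_(i < n, j < n) (x (i : nat, j : nat))%:R).
Proof.
rewrite /perm_chaos [2 ^+ n / _]mulrC -mulrA; congr (_ * _).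
rewrite /permanent mulr_sumr.
apply: eq_bigr => p _; rewrite prodfE size_mkseq.
rewrite (eq_bigr (fun k : 'I__ => 1 + on_graph p (cell k) * sgn R (x (cell k)))); last first.
  by move=> k _; rewrite nth_mkseq.
rewrite (prod_cells n (fun c => 1 + on_graph p c * sgn R (x c))).
rewrite (_ : 2 ^+ n = \prod_(i < n) 2); last by rewrite prodr_const card_ord.
rewrite -big_split/=; apply: eq_bigr => i _; rewrite mxE.
rewrite (bigD1 (p i))//= on_graphE eqxx mul1r big1 ?mulr1.
  by case: (x _) => /=; rewrite ?mulr1 ?mulr0 ?subrr.
by move=> j jp; rewrite on_graphE eq_sym (negbTE jp) mul0r addr0.
Qed.

(** On the products of two permutations [p] and [q p] the form [noiseB] takes the value
    [4 ^ k], with [k] the number of places where they agree, that is, of fixed points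
    of [q]; the mean over [q] does not depend on [p]. *)
Lemma noiseB_perm_chaos n : noiseB (n * n) (perm_chaos n) (perm_chaos n) <= expR 3.
Proof.
pose V : R := \sum_(s : 'S_n) \prod_(i < n) (1 + 3 * (s i == i)%:R).
have -> : noiseB (n * n) (perm_chaos n) (perm_chaos n) = (n`!%:R)^-1 * V; last first.
  exact: sum_perm_fixpoints.
have f0 : n`!%:R != 0 :> R by rewrite pnatr_eq0 -lt0n fact_gt0.
rewrite /perm_chaos noiseBZl noiseBC noiseBZl; congr (_ * _).
rewrite noiseB_sumr.
rewrite (eq_bigr (fun=> V)); last first.
  move=> p _; rewrite noiseBC noiseB_sumr /V (reindex_inj (mulIg p)) /=.
  apply: eq_bigr => q _; rewrite noiseB_prodf.
  rewrite (prod_cells n (fun c => 1 + 3 * (on_graph p c * on_graph (q * p)%g c))).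
  apply: eq_bigr => i _; rewrite (bigD1 (p i))//= !on_graphE eqxx mul1r permM.
  rewrite (inj_eq perm_inj) big1 ?mulr1//.
  by move=> j jp; rewrite !on_graphE [p i == j]eq_sym (negbTE jp) mul0r mulr0 addr0.
rewrite sumr_const card_Sn -[V *+ _]mulr_natr mulrCA mulVf ?mulr1//.
Qed.

Lemma noiseB_expo_chaos n : (0 < n)%N ->
  noiseB (n * n) (expo_chaos n) (expo_chaos n) <= expR 3.
Proof.
move=> n0; have n0' : n%:R != 0 :> R by rewrite pnatr_eq0 -lt0n.
rewrite /expo_chaos noiseB_prodf prodr_const card_ord.
apply: (@le_trans _ _ (expR (3 * (n%:R^-1 * n%:R^-1)) ^+ (n * n))).
  by rewrite lerXn2r ?nnegrE ?expR_ge0 ?addr_ge0 ?mulr_ge0 ?invr_ge0 ?expR_ge1Dx.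
rewrite -expRM_natl natrM le_eqVlt; apply/orP; left; apply/eqP; congr expR.
by field.
Qed.

Lemma noiseB_perm_expo_chaos n : (0 < n)%N ->
  expR 3 * (1 - 18 / n%:R) <= noiseB (n * n) (perm_chaos n) (expo_chaos n).
Proof.
move=> n0; have n0' : 0 < n%:R :> R by rewrite ltr0n.
have f0 : n`!%:R != 0 :> R by rewrite pnatr_eq0 -lt0n fact_gt0.
have -> : noiseB (n * n) (perm_chaos n) (expo_chaos n) = (1 + 3 / n%:R) ^+ n.
  rewrite /perm_chaos noiseBZl noiseBC noiseB_sumr.
  rewrite (eq_bigr (fun=> (1 + 3 / n%:R) ^+ n)); last first.
    move=> p _; rewrite /expo_chaos noiseB_prodf.
    rewrite (prod_cells n (fun c => 1 + 3 * (n%:R^-1 * on_graph p c))).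
    rewrite -[n in _ ^+ n]card_ord -prodr_const; apply: eq_bigr => i _.
    rewrite (bigD1 (p i))//= on_graphE eqxx mulr1 big1 ?mulr1//.
    by move=> j jp; rewrite on_graphE eq_sym (negbTE jp) !mulr0 addr0.
  by rewrite sumr_const card_Sn -[X in _ * X]mulr_natr mulrCA mulVf ?mulr1.
apply: (@le_trans _ _ (expR (3 / n%:R - 2 * (3 / n%:R) ^+ 2) ^+ n)).
  rewrite -expRM_natl [X in _ <= expR X](_ : _ = 3 + - (18 / n%:R)); last first.
    by field; rewrite gt_eqF.
  by rewrite [leRHS]expRD ler_pM2l ?expR_gt0// expR_ge1Dx.
have h : 0 <= 3 / n%:R :> R by rewrite divr_ge0// ltW.
by rewrite lerXn2r ?nnegrE ?expR_ge0 ?expR_le_1Dx//; lra.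
Qed.

(** [B (W, W) - 2 B (W, G) + B (G, G) <= 2 e ^ 3 - 2 e ^ 3 (1 - 18 / n)], then Bonami's
    inequality. *)
Lemma fourth_moment_bound n : (0 < n)%N ->
  cubeE (n * n) (fun s => (perm_chaos n s - expo_chaos n s) ^+ 4) <=
  (36 * expR 3) ^+ 2 / n%:R ^+ 2.
Proof.
move=> n0; have n0' : 0 < n%:R :> R by rewrite ltr0n.
apply: le_trans (bonami _ _) _.
have C0 : 0 <= 36 * expR 3 / n%:R :> R by rewrite divr_ge0 ?mulr_ge0 ?expR_ge0// ltW.
rewrite -expr_div_n lerXn2r ?nnegrE ?noiseB_ge0//.
rewrite noiseB_subr.
have := noiseB_perm_chaos n; have := noiseB_expo_chaos n0.
have := noiseB_perm_expo_chaos n0.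
have -> : 36 * expR 3 / n%:R = 2 * (expR 3 - expR 3 * (1 - 18 / n%:R)) :> R.
  by field; rewrite gt_eqF.
lra.
Qed.

End permanent_chaos.

Section expo_chaos_bounds.
Variable R : realType.

Lemma prodf_cst_le (a : R) s : 0 <= a <= 1 -> prodf (fun=> a) s <= expR (a * walk R s).
Proof.
move=> a01; elim: s => [|b s IH] /=; first by rewrite /walk big_nil mulr0 expR0.
rewrite walk_cons mulrDr expRD; apply: ler_pM; rewrite ?expR_ge1Dx//.
- by case: b; rewrite /sgn ?mulr1 ?mulrN1; lra.
- rewrite prodfE; apply: prodr_ge0 => i _.
  by rewrite /sgn; case: ifP; lra.
Qed.

Lemma prodf_cst_ge (a : R) s : 0 <= a <= 2^-1 ->
  expR (a * walk R s - 2 * a ^+ 2 * (size s)%:R) <= prodf (fun=> a) s.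
Proof.
move=> a01; elim: s => [|b s IH] /=.
  by rewrite /walk big_nil !mulr0 subrr expR0.
rewrite walk_cons -[(size s).+1%:R]natr1.
have -> : a * (sgn R b + walk R s) - 2 * a ^+ 2 * ((size s)%:R + 1) =
  (a * sgn R b - 2 * (a * sgn R b) ^+ 2) + (a * walk R s - 2 * a ^+ 2 * (size s)%:R).
  by rewrite /sgn; case: b; ring.
rewrite expRD; apply: ler_pM; rewrite ?expR_ge0//; apply: expR_le_1Dx.
by rewrite /sgn; case: b; lra.
Qed.

Lemma expo_chaos_le n s : (0 < n)%N -> expo_chaos R n s <= expR (walk R s / n%:R).
Proof.
move=> n0; rewrite mulrC; apply: prodf_cst_le.
by rewrite invr_ge0 ler0n invf_le1 ?ler1n ?ltr0n.
Qed.

Lemma expo_chaos_ge n s : (1 < n)%N -> size s = (n * n)%N ->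
  expR (walk R s / n%:R - 2) <= expo_chaos R n s.
Proof.
move=> n1 sn; have n0 : 0 < n%:R :> R by rewrite ltr0n (ltn_trans _ n1).
apply: le_trans (@prodf_cst_ge n%:R^-1 s _); last first.
  by rewrite invr_ge0 ler0n lef_pV2 ?posrE// ler_nat.
rewrite ler_expR sn natrM le_eqVlt; apply/orP; left; apply/eqP.
by field; rewrite gt_eqF.
Qed.

End expo_chaos_bounds.

(** * From matrix entries to fair bits *)

Section random_bits.
Context (d : measure_display) (T : measurableType d) (R : realType)
  (P : probability T R) (xi : nat -> nat -> {RV P >-> R}).
Hypothesis xi_indep : mutually_independent (fun ij : nat * nat => xi ij.1 ij.2).
Hypothesis xi_0 : forall i j : nat, P [set w | xi i j w = 0] = (2^-1)%:E.
Hypothesis xi_1 : forall i j : nat, P [set w | xi i j w = 1] = (2^-1)%:E.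

(** An entry is 0 or 1 only almost surely; its bit is defined everywhere. *)
Definition bits (w : T) (c : nat * nat) : bool := xi c.1 c.2 w == 1.

Definition bit_prefix (w : T) (N : nat) : seq bool := read_cells (bits w) N.

Lemma size_bit_prefix w N : size (bit_prefix w N) = N.
Proof. exact: size_mkseq. Qed.

Lemma bit_prefixS w N : bit_prefix w N.+1 = rcons (bit_prefix w N) (bits w (cell N)).
Proof. by rewrite /bit_prefix /read_cells /mkseq -addn1 iotaD map_cat cats1. Qed.

Lemma take_bit_prefix w m n : (m <= n)%N -> take m (bit_prefix w n) = bit_prefix w m.
Proof.
by move=> mn; rewrite /bit_prefix /read_cells /mkseq -map_take take_iota (minn_idPl mn).
Qed.

Let F (N : nat) : {fset nat * nat} := [fset c in mkseq cell N]%fset.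
Let B (s : seq bool) (c : nat * nat) : set R :=
  if nth false s (index c (mkseq cell (size s))) then [set 1] else ~` [set 1].

Let prefix_eqE s : [set w | bit_prefix w (size s) = s] =
  \bigcap_(c in [set` F (size s)]) (xi c.1 c.2 @^-1` B s c).
Proof.
have idx k : (k < size s)%N -> index (cell k) (mkseq cell (size s)) = k.
  move=> ks; rewrite -[X in index X _](nth_mkseq (0%N, 0%N) cell ks).
  by rewrite index_uniq ?size_mkseq// mkseq_uniq//; exact: cell_inj.
have BE w k : (k < size s)%N ->
    B s (cell k) (xi (cell k).1 (cell k).2 w) <-> bits w (cell k) = nth false s k.
  move=> ks; rewrite /B idx// /bits; case: (nth false s k) => /=.
    by split=> [->|/eqP//]; rewrite eqxx.
  by split=> [/eqP/negbTE//|h /eqP]; rewrite h.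
apply/seteqP; split => w /=.
  move=> sE c /=; rewrite in_fset => /mapP[k]; rewrite mem_iota add0n => /= ks ->.
  by apply/BE => //; rewrite -[in RHS]sE nth_mkseq.
move=> h; apply: (@eq_from_nth _ false); first by rewrite size_bit_prefix.
move=> k; rewrite size_bit_prefix => ks; rewrite nth_mkseq//.
apply/BE => //; apply: h; rewrite /= in_fset; apply/mapP; exists k => //.
by rewrite mem_iota.
Qed.

Let measurable_B s c : measurable (B s c).
Proof.
by rewrite /B; case: ifP => _; [exact: measurable_set1|apply: measurableC; exact: measurable_set1].
Qed.

Let measurable_bit_prefix_eq s : measurable [set w | bit_prefix w (size s) = s].
Proof.
rewrite prefix_eqE; apply: fin_bigcap_measurable; first exact: finite_fset.
move=> c _; rewrite -[X in measurable X]setTI; exact: measurable_funPT.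
Qed.

Let prob_bit_prefix_eq s : P [set w | bit_prefix w (size s) = s] = (2^-1 ^+ size s)%:E.
Proof.
rewrite prefix_eqE (xi_indep (B := B s)) => [|c _]; last exact: measurable_B.
rewrite (eq_bigr (fun=> (2^-1 : R)%:E)); last first.
  move=> c _; rewrite /B; case: ifP => _; first exact: xi_1.
  rewrite -preimage_setC probability_setC.
    rewrite (xi_1 c.1 c.2 : P (xi c.1 c.2 @^-1` [set 1]) = _).
    by rewrite -EFinB; congr (_%:E); lra.
  by rewrite -[X in measurable X]setTI; apply: measurable_funPT.
have prod_half (r : seq (nat * nat)) :
    (\prod_(c <- r) (2^-1)%:E)%E = (2^-1 ^+ size r)%:E :> \bar R.
  elim: r => [|c r IH]; first by rewrite big_nil expr0.
  by rewrite big_cons IH /= -EFinM exprS.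
rewrite prod_half; congr ((_ ^+ _)%:E).
rewrite card_fseq undup_id ?size_mkseq// mkseq_uniq//; exact: cell_inj.
Qed.

(* Conditioning on the first [size s] bits and splitting on the next one is the
   recursion that defines [cubeE]. *)
Let prob_bit_prefix_from N s (Q : pred (seq bool)) :
  measurable [set w | bit_prefix w (size s) = s /\ Q (bit_prefix w (size s + N))] /\
  P [set w | bit_prefix w (size s) = s /\ Q (bit_prefix w (size s + N))] =
  (2^-1 ^+ size s * cubeE N (fun u => (Q (s ++ u))%:R))%:E.
Proof.
elim: N s => [|N IH] s.
  rewrite addn0 /= cats0; have [Qs|Qs] := boolP (Q s).
    have -> : [set w | bit_prefix w (size s) = s /\ Q (bit_prefix w (size s))] =
        [set w | bit_prefix w (size s) = s].
      by apply/seteqP; split => w /= => [[]|->].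
    by rewrite mulr1; split; [exact: measurable_bit_prefix_eq|exact: prob_bit_prefix_eq].
  have -> : [set w | bit_prefix w (size s) = s /\ Q (bit_prefix w (size s))] = set0.
    by apply/seteqP; split => w //= [->]; rewrite (negbTE Qs).
  by rewrite mulr0 measure0.
have [mt pt] := IH (rcons s true); have [mf pf] := IH (rcons s false).
have splitE : [set w | bit_prefix w (size s) = s /\ Q (bit_prefix w (size s + N.+1))] =
   [set w | bit_prefix w (size (rcons s true)) = rcons s true /\
      Q (bit_prefix w (size (rcons s true) + N))] `|`
   [set w | bit_prefix w (size (rcons s false)) = rcons s false /\
      Q (bit_prefix w (size (rcons s false) + N))].
  rewrite !size_rcons addSnnS; apply/seteqP; split => w /=.
    move=> [sE Qw]; rewrite bit_prefixS sE.
    by case: (bits w _); [left|right].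
  by rewrite !bit_prefixS => -[|] [/rcons_inj[-> _] ->].
rewrite splitE; split; first exact: measurableU.
rewrite measureU//; last first.
  apply/seteqP; split => w //= [[+ _] [+ _]]; rewrite !size_rcons => -> /rcons_inj.
  by case.
transitivity (P [set w | bit_prefix w (size (rcons s true)) = rcons s true /\
      Q (bit_prefix w (size (rcons s true) + N))] +
  P [set w | bit_prefix w (size (rcons s false)) = rcons s false /\
      Q (bit_prefix w (size (rcons s false) + N))])%E; first by [].
rewrite pt pf !size_rcons -EFinD; congr (_%:E).
rewrite (@eq_cubeE _ N (fun u => (Q (rcons s true ++ u))%:R)
  (fun u => (Q (s ++ true :: u))%:R)); last first.
  by move=> u _; rewrite cat_rcons.
rewrite (@eq_cubeE _ N (fun u => (Q (rcons s false ++ u))%:R)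
  (fun u => (Q (s ++ false :: u))%:R)); last first.
  by move=> u _; rewrite cat_rcons.
by rewrite [cubeE N.+1 _]/= exprS; field.
Qed.

Lemma measurable_bit_prefix N (Q : pred (seq bool)) :
  measurable [set w | Q (bit_prefix w N)].
Proof.
have [+ _] := prob_bit_prefix_from N [::] Q; congr (measurable _).
by apply/seteqP; split => w /=; [case|].
Qed.

(** The bits along the enumeration of the positions are independent and fair. *)
Lemma prob_bit_prefix N (Q : pred (seq bool)) :
  P [set w | Q (bit_prefix w N)] = (cubeE N (fun s => (Q s)%:R))%:E.
Proof.
have [_] := prob_bit_prefix_from N [::] Q; rewrite expr0 mul1r => <-; congr (P _).
by apply/seteqP; split => w /=; [|case].
Qed.

Lemma ae_xi_bits : {ae P, forall w, forall i j, xi i j w = (bits w (i, j))%:R}.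
Proof.
apply: ae_foralln => i; apply: ae_foralln => j.
have m c : measurable (xi i j @^-1` [set c]).
  by rewrite -[X in measurable X]setTI; apply: measurable_funPT.
pose A := xi i j @^-1` [set 0] `|` xi i j @^-1` [set 1].
have mA : measurable A by apply: measurableU.
exists (~` A); split; first exact: measurableC.
  have PA : P A = 1%E.
    rewrite measureU//; last first.
      by apply/seteqP; split => w //= [-> /eqP]; rewrite eq_sym oner_eq0.
    transitivity (P (xi i j @^-1` [set 0%R]) + P (xi i j @^-1` [set 1%R]))%E => //.
    rewrite (xi_1 i j : P (xi i j @^-1` [set 1]) = _).
    rewrite (xi_0 i j : P (xi i j @^-1` [set 0]) = _) -EFinD.
    by congr (_%:E); lra.
  transitivity (P (~` A)); first by [].
  by rewrite probability_setC// PA subee.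
move=> w /= h hA; apply: h; rewrite /bits /=.
by case: hA => /= ->; rewrite ?eqxx// eq_sym oner_eq0.
Qed.

Lemma borel_cantelli1 (N : nat -> nat) (Q : nat -> pred (seq bool)) (C : R) :
  (forall K, \sum_(k < K) cubeE (N k) (fun s => (Q k s)%:R) <= C) ->
  {ae P, forall w, exists k0, forall k, (k0 <= k)%N -> ~~ Q k (bit_prefix w (N k))}.
Proof.
move=> QC; pose A k := [set w | Q k (bit_prefix w (N k))].
have mA k : measurable (A k) by exact: measurable_bit_prefix.
exists (lim_sup_set A); split.
- apply: bigcap_measurable => // n _.
  by apply: bigcup_measurable => k _; exact: mA.
- apply: lim_sup_set_cvg0 => //.
  apply: (@le_lt_trans _ _ C%:E); last by rewrite ltry.
  apply: lime_le.
    by apply: is_cvg_nneseries => n _ _; exact: measure_ge0.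
  apply: nearW => K.
  rewrite (eq_bigr (fun k => (cubeE (N k) (fun s => (Q k s)%:R))%:E)); last first.
    by move=> k _; exact: prob_bit_prefix.
  by rewrite sumEFin lee_fin big_mkord.
- move=> w /= h n _; apply: contrapT => hn; apply: h; exists n => k nk.
  by apply/negP => Qk; apply: hn; exists k.
Qed.

(** The blocks of bits from [M k] to [M k.+1] are disjoint, so the probability that
    none of [Q k0, ..., Q (k0 + j - 1)] occurs is [prod (1 - p_k) <= exp (- sum p_k)],
    which tends to 0. *)
Lemma borel_cantelli2 (M : nat -> nat) (Q : nat -> pred (seq bool)) :
  {homo M : m n / (m <= n)%N} ->
  (forall (k0 : nat) (C : R), exists K,
     C <= \sum_(k0 <= k < K) cubeE (M k.+1 - M k) (fun s => (Q k s)%:R)) ->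
  {ae P, forall w, forall k0, exists2 k, (k0 <= k)%N &
     Q k (drop (M k) (bit_prefix w (M k.+1)))}.
Proof.
move=> Mle Qdiv; apply: ae_foralln => k0.
pose p k : R := cubeE (M k.+1 - M k) (fun s => (Q k s)%:R).
(* [none j s]: no block event of index between [k0] and [k0 + j - 1] occurs in [s]. *)
pose fix none j : pred (seq bool) := if j is j'.+1 then
  fun s => none j' (take (M (k0 + j')%N) s) && ~~ Q (k0 + j')%N (drop (M (k0 + j')%N) s)
  else xpredT.
have noneE j : cubeE (M (k0 + j)%N) (fun s => (none j s)%:R) <=
    expR (- \sum_(k0 <= k < k0 + j) p k).
  elim: j => [|j IH]; first by rewrite addn0 big_geq// oppr0 expR0 cubeE_cst.
  rewrite addnS big_nat_recr ?leq_addr//= opprD expRD.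
  have Mj : (M (k0 + j)%N <= M (k0 + j).+1%N)%N by apply: Mle.
  rewrite -{1}(subnKC Mj).
  rewrite (@eq_cubeE _ _ _ (fun s => (none j (take (M (k0 + j)%N) s))%:R *
      (~~ Q (k0 + j)%N (drop (M (k0 + j)%N) s))%:R)); last first.
    by move=> s _; rewrite -natrM mulnb.
  rewrite (cubeE_cat _ _ (fun s => (none j s)%:R) (fun s => (~~ Q (k0 + j)%N s)%:R)).
  apply: ler_pM => //; [by apply: cubeE_ge0|by apply: cubeE_ge0|].
  apply: le_trans (expR_ge1Dx _); rewrite /p.
  rewrite -[X in _ <= X - _](cubeE_cst (M (k0 + j).+1%N - M (k0 + j)%N)%N 1).
  by rewrite -cubeEB; apply: cubeE_le => s _; case: (Q _ s); rewrite /= ?subr0 ?subrr.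
have noneP j w : (forall k, (k0 <= k < k0 + j)%N -> ~~ Q k (drop (M k) (bit_prefix w (M k.+1)))) ->
    none j (bit_prefix w (M (k0 + j)%N)).
  elim: j => //= j IH h; rewrite addnS take_bit_prefix; last exact: Mle.
  rewrite IH ?h//=; first by lia.
  by move=> k hk; apply: h; lia.
pose A := \bigcap_j [set w | none j (bit_prefix w (M (k0 + j)%N))].
have mA : measurable A.
  by apply: bigcap_measurable => // j _; exact: measurable_bit_prefix.
exists A; split => //.
  apply/eqP; rewrite eq_le measure_ge0 andbT; apply/lee_addgt0Pr => e e0.
  rewrite add0e; have [K hK] := Qdiv k0 (e^-1).
  pose j := (K - k0)%N.
  apply: (@le_trans _ _ (P [set w | none j (bit_prefix w (M (k0 + j)%N))])).
    have sA : A `<=` [set w | none j (bit_prefix w (M (k0 + j)%N))] by exact: bigcap_inf.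
    exact: (le_measure P (mem_set mA) (mem_set (measurable_bit_prefix _ _)) sA).
  rewrite prob_bit_prefix lee_fin; apply: le_trans (noneE j) _.
  have {}hK : e^-1 <= \sum_(k0 <= k < k0 + j) p k.
    have [Kk|kK] := leqP K k0; last by rewrite subnKC// ltnW.
    by rewrite big_geq// in hK; rewrite big_geq//; lia.
  rewrite expRN -[leRHS]invrK lef_pV2 ?posrE ?expR_gt0 ?invr_gt0//.
  by apply: le_trans (expR_ge1Dx _); lra.
move=> w /= h j _; apply: noneP => k /andP[k0k _].
by apply/negP => Qk; apply: h; exists k.
Qed.

End random_bits.

(** * Logarithmic sums and scales *)

Section log_sums.
Variable R : realType.

Definition lil_scale (n : nat) : R := Num.sqrt (2 * ln (ln n%:R)).

Lemma ln_le_subr1 (x : R) : 0 < x -> ln x <= x - 1.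
Proof.
move=> x0; rewrite -{1}(_ : 1 + (x - 1) = x); last by ring.
by apply: le_ln1Dx; lra.
Qed.

Lemma ln_pred_le (k : nat) : ln k.+1%:R <= ln k.+2%:R - (k.+2%:R)^-1 :> R.
Proof.
have p1 : 0 < k.+1%:R :> R by rewrite ltr0n.
have p2 : 0 < k.+2%:R :> R by rewrite ltr0n.
have := ln_le_subr1 (divr_gt0 p1 p2); rewrite ln_div ?posrE//.
have -> : k.+1%:R / k.+2%:R = 1 - (k.+2%:R)^-1 :> R.
  rewrite -[k.+2%:R]natr1; move: p1; set x := k.+1%:R => p1.
  by field; apply: lt0r_neq0; lra.
by move: (ln _) (ln _) (_^-1) => a b c; lra.
Qed.

(** Convergence of [sum k ^ -(1 + e)] by telescoping:
    [e k ^ -(1 + e) <= (k - 1) ^ -e - k ^ -e], because [ln (k - 1) <= ln k - 1 / k]. *)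
Lemma sum_pseries_le (e : R) K : 0 < e ->
  \sum_(k < K) expR (- ((1 + e) * ln k.+1%:R)) <= 1 + e^-1.
Proof.
move=> e0; have ei0 : 0 < e^-1 by rewrite invr_gt0.
case: K => [|K]; first by rewrite big_ord0; lra.
apply: (@le_trans _ _ (1 + e^-1 * (1 - expR (- (e * ln K.+1%:R))))); last first.
  by rewrite lerD2l -[leRHS]mulr1 ler_pM2l// gerBl expR_ge0.
elim: K => [|K IH].
  by rewrite big_ord_recl big_ord0 ln1 !mulr0 oppr0 expR0; lra.
rewrite big_ord_recr/=; apply: le_trans (lerD IH (lexx _)) _.
set x := K.+2%:R; have x0 : 0 < x :> R by rewrite ltr0n.
have h1 : expR (- (e * ln x)) * (1 + e / x) <= expR (- (e * ln K.+1%:R)).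
  apply: (@le_trans _ _ (expR (- (e * ln x)) * expR (e / x))).
    by rewrite ler_pM2l ?expR_gt0 ?expR_ge1Dx.
  rewrite -expRD ler_expR; have := ln_pred_le K; rewrite -/x.
  by move: (ln x) (ln _) (x^-1) => a b c; nra.
have h2 : expR (- ((1 + e) * ln x)) = expR (- (e * ln x)) / x.
  by rewrite mulrDl mul1r opprD expRD mulrC [expR (- ln x)]expRN lnK ?posrE.
rewrite h2.
have -> : expR (- (e * ln x)) / x =
    e^-1 * (expR (- (e * ln x)) * (1 + e / x) - expR (- (e * ln x))).
  by field; rewrite !gt_eqF.
move: h1; rewrite -/x; set w := _ * (1 + e / x).
by move: w (expR (- (e * ln K.+1%:R))) (expR _) => w u v h1; nra.
Qed.

Lemma sum_inv_ge_ln k0 K : (k0 <= K)%N ->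
  ln K.+1%:R - ln k0.+1%:R <= \sum_(k0 <= k < K) (k.+1%:R)^-1 :> R.
Proof.
elim: K => [|K IH]; first by rewrite leqn0 => /eqP ->; rewrite subrr big_geq.
rewrite leq_eqVlt => /orP[/eqP ->|]; first by rewrite subrr big_geq.
rewrite ltnS => k0K; rewrite big_nat_recr//=; have {}IH := IH k0K.
suff h : ln K.+2%:R <= ln K.+1%:R + (K.+1%:R)^-1 :> R.
  by rewrite lerBlDr addrAC; apply: le_trans h _; rewrite lerD2r -lerBlDr.
have p1 : 0 < K.+1%:R :> R by rewrite ltr0n.
have p2 : 0 < K.+2%:R :> R by rewrite ltr0n.
have := ln_le_subr1 (divr_gt0 p2 p1); rewrite ln_div ?posrE//.
have -> : K.+2%:R / K.+1%:R = 1 + (K.+1%:R)^-1 :> R.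
  rewrite -[K.+2%:R]natr1; move: p1; set x := K.+1%:R => p1.
  by field; apply: lt0r_neq0.
by move: (ln _) (ln _) (_^-1) => a b c; lra.
Qed.

Lemma exists_ln_ge (x : R) k0 : exists2 k, (k0 <= k)%N & x <= ln k.+1%:R.
Proof.
exists (maxn k0 (Num.truncn (expR x))); first exact: leq_maxl.
rewrite -[leLHS]expRK ler_ln ?posrE ?expR_gt0 ?ltr0n//.
apply: le_trans (ltW (truncnS_gt _)) _.
by rewrite ler_nat ltnS leq_maxr.
Qed.

Lemma sum_inv_diverges (c : R) k0 C : 0 < c ->
  exists K, C <= \sum_(k0 <= k < K) c / k.+1%:R.
Proof.
move=> c0; have [K k0K hK] := exists_ln_ge (C / c + ln k0.+1%:R) k0.
exists K; rewrite -mulr_sumr mulrC -ler_pdivrMr//.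
by have := sum_inv_ge_ln k0K; lra.
Qed.

Lemma geometric_block (q : R) n : 1 < q -> (0 < n)%N ->
  exists k, q ^+ k <= n%:R < q ^+ k.+1.
Proof.
move=> q1 n0; have q0 : 0 < q by lra.
have hj : exists j, n%:R < q ^+ j.
  exists (Num.truncn (ln n%:R / ln q)).+1.
  have lq : 0 < ln q by rewrite ln_gt0.
  rewrite -ltr_ln ?posrE ?exprn_gt0 ?ltr0n// lnXn//.
  rewrite -[X in _ < X]mulr_natl.
  by rewrite -ltr_pdivrMr// truncnS_gt.
case: (ex_minnP hj) => -[|k] hk kmin.
  by move: hk; rewrite expr0 ltrn1 ltnNge n0.
exists k; rewrite hk andbT leNgt; apply/negP => /kmin; by rewrite ltnn.
Qed.

End log_sums.

(** * The walk between factorial times *)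

Section factorial_blocks.
Variable R : realType.

(** With [x = ln (k + 1)] and [(k + 1)! <= (k + 1) ^ (k + 1)] one gets
    [ln ln (k + 1)! <= x + ln x], and [ln x = 2 ln (sqrt x) <= 2 sqrt x <= e x]. *)
Lemma lil_scale_fact_le (e : R) k : 0 < e -> 2 / e <= Num.sqrt (ln k.+1%:R) ->
  lil_scale R k.+1`! <= (1 + e) * Num.sqrt (2 * ln k.+1%:R).
Proof.
move=> e0; set x := ln k.+1%:R; set y := Num.sqrt x => ey.
have y0 : 0 < y by apply: lt_le_trans ey; rewrite divr_gt0.
have x0 : 0 < x by rewrite -sqrtr_gt0.
have xy : x = y ^+ 2 by rewrite sqr_sqrtr// ltW.
have k0 : 0 < k.+1%:R :> R by rewrite ltr0n.
have f0 : 0 < (k.+1`!)%:R :> R by rewrite ltr0n fact_gt0.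
have f1 : ln (k.+1`!)%:R <= k.+1%:R * x.
  have fk j : (j`! <= j ^ j)%N.
    elim: j => // j IH; rewrite factS expnS leq_mul//.
    by apply: leq_trans IH _; case: j => // j; rewrite leq_exp2r.
  rewrite mulr_natl /x -lnXn// ler_ln ?posrE ?exprn_gt0// -natrX ler_nat.
  exact: fk.
have f2 : x <= ln (k.+1`!)%:R.
  by rewrite ler_ln ?posrE// ler_nat fact_geq.
have f3 : ln (ln (k.+1`!)%:R) <= (1 + e) * x.
  apply: (@le_trans _ _ (ln (k.+1%:R * x))).
    by rewrite ler_ln ?posrE ?mulr_gt0//; exact: lt_le_trans f2.
  rewrite lnM ?posrE// mulrDl mul1r lerD2l xy lnXn// mulr2n.
  have := ln_le_subr1 y0; move: ey; rewrite ler_pdivrMr//.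
  by move: (ln y) => z; nra.
have e1 : 0 <= 1 + e by lra.
rewrite /lil_scale -[1 + e](ger0_norm e1) -sqrtr_sqr.
rewrite -sqrtrM ?sqr_ge0// ler_wsqrtr// mulrCA ler_wpM2l//.
apply: le_trans f3 _; apply: ler_wpM2r; first exact: ltW.
by rewrite expr2 ler_peMr//; lra.
Qed.

(** The number of entries of the minor of order [k!]. *)
Definition block_end (k : nat) : nat := (k`! * k`!)%N.

Definition block_len (k : nat) : nat := (block_end k.+1 - block_end k)%N.

Lemma block_end_homo : {homo block_end : m n / (m <= n)%N}.
Proof.
move=> m n mn; suff h : (m`! <= n`!)%N by rewrite leq_mul.
by case: m mn => [_|m mn]; [rewrite fact_gt0|rewrite leq_pfact// inE; lia].
Qed.

Lemma block_len_bounds k :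
  (k * k`! * (k * k`!) <= block_len k <= (k.+1)`! * (k.+1)`!)%N.
Proof. by rewrite /block_len /block_end factS; nia. Qed.

(** The deviation, in units of the standard deviation, asked of the increment of the walk
    over block [k]; it is nearly [lil_scale] at [(k + 1)!]. *)
Definition block_dev (e : R) k : R := (1 - e) * Num.sqrt (2 * ln k.+1%:R).

Definition good_block e k : pred (seq bool) := fun s =>
  Num.sqrt (block_len k)%:R * (block_dev e k - 2) <= walk R s.

Lemma ln_le_nat k : ln k.+1%:R <= k%:R :> R.
Proof.
apply: le_trans (ln_le_subr1 _) _; first by rewrite ltr0n.
by rewrite -natr1 addrK.
Qed.

(** With [r = sqrt (2 ln (k + 1))], the tail bound at [b = (1 - e) r] has exponent
    [b ^ 2 / 2 + 2 b <= (1 - e) r ^ 2 / 2 + 2 r <= r ^ 2 / 2 + 2 / e], the last step by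
    [2 r <= e r ^ 2 / 2 + 2 / e].  This is [ln (k + 1)] up to a constant, hence the
    divergent lower bound [c / (k + 1)]. *)
Lemma good_block_prob e k : 0 < e <= 1 -> (4 <= k)%N ->
  4^-1 * expR (- (2 / e)) / k.+1%:R <=
  cubeE (block_len k) (fun s => (good_block e k s)%:R).
Proof.
move=> /andP[e0 e1] k4; set b := block_dev e k.
have k0 : 0 < k.+1%:R :> R by rewrite ltr0n.
pose r := Num.sqrt (2 * ln k.+1%:R) : R.
have x0 : 0 <= ln k.+1%:R :> R by rewrite ln_ge0// ler1n.
have r0 : 0 <= r by exact: sqrtr_ge0.
have rE : r ^+ 2 = 2 * ln k.+1%:R by rewrite sqr_sqrtr// mulr_ge0.
have bE : b = (1 - e) * r by [].
have rk : r ^+ 2 <= 2 * k%:R by rewrite rE ler_pM2l// ln_le_nat.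
have b0 : 0 <= b by rewrite bE mulr_ge0//; lra.
have br : b <= r by rewrite bE; nra.
have /andP[len1 _] := block_len_bounds k.
have len0 : (16 * (k * k) <= block_len k)%N.
  apply: leq_trans len1; have kf := fact_geq k; nia.
apply: le_trans (walk_upper_tail b0 _ _).
- have -> : (k.+1%:R)^-1 = expR (- ln k.+1%:R) :> R by rewrite expRN lnK ?posrE.
  rewrite -mulrA -expRD ler_pM2l ?invr_gt0// ler_expR -opprD lerN2 bE.
  have h : (1 - e) ^+ 2 * r ^+ 2 <= r ^+ 2 - e * r ^+ 2.
    by have := sqr_ge0 r; nra.
  have h2 : 2 * ((1 - e) * r) <= 2 * r by nra.
  have h3 : 2 * r <= e / 2 * r ^+ 2 + 2 / e.
    have : 0 <= e / 2 * (r - 2 / e) ^+ 2 by rewrite mulr_ge0 ?sqr_ge0 ?divr_ge0 ?ltW.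
    have -> : e / 2 * (r - 2 / e) ^+ 2 = e / 2 * r ^+ 2 + 2 / e - 2 * r.
      by field; rewrite gt_eqF.
    by rewrite subr_ge0.
  rewrite exprMn; move: h h2 h3 rE; move: (r ^+ 2) ((1 - e) ^+ 2) (2 / e) (ln _) => A B C D.
  nra.
- by apply: leq_trans len0; nia.
- apply: (@le_trans _ _ (16 * (k%:R * k%:R))).
    have b2 : b ^+ 2 <= 2 * k%:R by apply: le_trans rk; rewrite lerXn2r.
    have : b ^+ 2 * b ^+ 2 <= 2 * k%:R * (2 * k%:R) by rewrite ler_pM ?sqr_ge0.
    rewrite -exprD; lra.
  by rewrite -!natrM ler_nat.
Qed.

End factorial_blocks.

(** * The law of the iterated logarithm for the walk *)

Section walk_lil.
Context (d : measure_display) (T : measurableType d) (R : realType)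
  (P : probability T R) (xi : nat -> nat -> {RV P >-> R}).
Hypothesis xi_indep : mutually_independent (fun ij : nat * nat => xi ij.1 ij.2).
Hypothesis xi_1 : forall i j : nat, P [set w | xi i j w = 1] = (2^-1)%:E.

(** On the block [q ^ k <= n < q ^ (k + 1)], [q = 1 + e], the level [lev k] is at most the
    bound to be proved, and the walk lasts at most [q ^ (2 k + 2)] steps.  The maximal
    inequality gives a probability at most [(k ln q) ^ - (q ^ 2)], which is summable
    because [q ^ 2 > 1]. *)
Lemma ae_walk_upper (e : R) : 0 < e ->
  {ae P, forall w, exists n0, forall n, (n0 <= n)%N ->
    walk R (bit_prefix xi w (n * n)) <= (1 + e) ^+ 2 * (n%:R * lil_scale R n)}.
Proof.
move=> e0; pose q := 1 + e; have q1 : 1 < q by rewrite /q; lra.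
have q0 : 0 < q by lra.
have c0 : 0 < ln q by rewrite ln_gt0.
pose m k := Num.truncn (q ^+ k.+1).
pose lev k := q ^+ 2 * (q ^+ k * Num.sqrt (2 * ln (k%:R * ln q))).
have lev0 k : 0 <= lev k by rewrite !mulr_ge0 ?exprn_ge0 ?sqrtr_ge0// ltW.
pose k1 := (Num.truncn (ln q)^-1).+1.
(* From [k1] on, [ln (k * ln q)] is positive. *)
have k1P k : (k1 <= k)%N -> 1 < k%:R * ln q.
  move=> k1k; rewrite -ltr_pdivrMr// div1r; apply: lt_le_trans (truncnS_gt _) _.
  by rewrite ler_nat.
have m0 k : (0 < m k)%N by rewrite truncn_gt0 exprn_ege1// ltW.
have mq k : (m k)%:R <= q ^+ k.+1 by rewrite truncn_le exprn_ge0// ltW.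
have tail K : \sum_(k < K) cubeE (m (k1 + k)%N * m (k1 + k)%N)
     (fun s => (crosses (lev (k1 + k)%N) s)%:R) <=
    expR (- ((1 + e) * ln (ln q))) * (1 + e^-1).
  apply: le_trans (ler_wpM2l (expR_ge0 _) (sum_pseries_le K e0)).
  rewrite mulr_sumr; apply: ler_sum => i _; set k := (k1 + i)%N.
  have kq := k1P k (leq_addr _ _).
  have k0 : (0 < k)%N by [].
  apply: le_trans (maximal_walk (lev0 k) _) _; first by rewrite muln_gt0 m0.
  rewrite -expRD ler_expR -opprD lerN2.
  have lk : 0 <= ln (k%:R * ln q) by rewrite ln_ge0// ltW.
  apply: (@le_trans _ _ ((1 + e) * ln (k%:R * ln q))).
    rewrite lnM ?posrE ?ltr0n// mulrDr addrC lerD2r ler_pM2l//.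
    by rewrite ler_ln ?posrE ?ltr0n// ler_nat /k; lia.
  apply: (@le_trans _ _ (q ^+ 2 * ln (k%:R * ln q))).
    by rewrite ler_wpM2r// expr2 ler_peMr// ltW.
  rewrite ler_pdivlMr ?mulr_gt0 ?ltr0n ?muln_gt0 ?m0//.
  rewrite /lev !exprMn sqr_sqrtr ?mulr_ge0// natrM.
  have hm : (m k)%:R * (m k)%:R <= (q ^+ k) ^+ 2 * q ^+ 2 :> R.
    by rewrite -exprMn -exprSr expr2; apply: ler_pM; rewrite ?mq.
  have q2 : 0 <= q ^+ 2 by rewrite exprn_ge0// ltW.
  have := ler_wpM2l (mulr_ge0 q2 lk) hm.
  by move: (_ * _%:R) (q ^+ k) (ln _) => M X Y; lra.
have := borel_cantelli1 xi_indep xi_1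
  (N := fun k => (m (k1 + k) * m (k1 + k))%N) (Q := fun k => crosses (lev (k1 + k)%N)) tail.
apply: filterS => w [k0 hk0].
exists (Num.truncn (q ^+ (k1 + k0))).+1 => n hn.
have n0 : (0 < n)%N by apply: leq_trans hn.
have [k /andP[kn nk]] := geometric_block q1 n0.
have kk : (k1 + k0 <= k)%N.
  rewrite leqNgt; apply/negP => klt.
  have : q ^+ k.+1 <= n%:R.
    apply: (@le_trans _ _ (q ^+ (k1 + k0))).
      by apply: ler_weXn2l => //; exact: ltW.
    by apply: le_trans (ltW (truncnS_gt _)) _; rewrite ler_nat.
  by rewrite leNgt nk.
have nm : (n <= m k)%N.
  by rewrite truncn_ge_nat ?exprn_ge0// ?ltW.
have := hk0 (k - k1)%N; rewrite subnKC; last by lia.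
move=> /(_ _)/negP ncross.
have {ncross} : walk R (bit_prefix xi w (n * n)) < lev k.
  rewrite ltNge; apply/negP => hlev; apply: ncross; first by lia.
  apply: (@crosses_take _ _ (n * n)%N).
  by rewrite take_bit_prefix// leq_mul.
move=> /ltW/le_trans; apply.
have kq := k1P k (leq_trans (leq_addr _ _) kk).
have n0' : 0 < n%:R :> R by rewrite ltr0n.
apply: ler_wpM2l; first by rewrite exprn_ge0// ltW.
apply: ler_pM => //; rewrite ?sqrtr_ge0// ?exprn_ge0//; first exact: ltW.
rewrite /lil_scale ler_wsqrtr// ler_wpM2l//.
have h : k%:R * ln q <= ln n%:R.
  by rewrite mulr_natl -lnXn// ler_ln ?posrE ?exprn_gt0.
have p1 : 0 < k%:R * ln q by apply: lt_trans kq.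
by rewrite ler_ln ?posrE// (lt_le_trans p1 h).
Qed.

(** The Chernoff bound is [exp (- k ^ 2 / 2) <= e ^ 2 (k + 1) ^ -2], which is summable. *)
Lemma ae_block_start :
  {ae P, forall w, exists k0, forall k, (k0 <= k)%N ->
    - (k%:R * k`!%:R) < walk R (bit_prefix xi w (block_end k))}.
Proof.
pose Q k : pred (seq bool) := fun s => walk R s <= - (k%:R * k`!%:R).
have tail K : \sum_(k < K) cubeE (block_end k) (fun s => (Q k s)%:R) <=
    expR 2 * (1 + 1^-1) :> R.
  apply: le_trans (ler_wpM2l (expR_ge0 _) (sum_pseries_le K ltr01)).
  rewrite mulr_sumr; apply: ler_sum => k _.
  have f0 : 0 < k`!%:R :> R by rewrite ltr0n fact_gt0.
  apply: le_trans (walk_lower_tail (mulr_ge0 (ler0n _ _) (ltW f0)) _) _.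
    by rewrite muln_gt0 fact_gt0.
  rewrite -expRD ler_expR /block_end natrM.
  have -> : (k%:R * k`!%:R) ^+ 2 / (2 * (k`!%:R * k`!%:R)) = k%:R ^+ 2 / 2 :> R.
    by field; rewrite gt_eqF.
  have := ln_le_nat R k; have := sqr_ge0 (k%:R - 2 : R).
  by move: (ln _) (k%:R : R) => x y; nra.
have := borel_cantelli1 xi_indep xi_1 (N := block_end) (Q := Q) tail.
apply: filterS => w [k0 hk0]; exists k0 => k /hk0.
by rewrite /Q -ltNge.
Qed.

Lemma ae_good_blocks (e : R) : 0 < e <= 1 ->
  {ae P, forall w, forall k0, exists2 k, (k0 <= k)%N &
    good_block e k (drop (block_end k) (bit_prefix xi w (block_end k.+1)))}.
Proof.
move=> e01; apply: (borel_cantelli2 xi_indep xi_1 block_end_homo) => k0 C.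
have c0 : 0 < 4^-1 * expR (- (2 / e)) by rewrite mulr_gt0 ?expR_gt0 ?invr_gt0.
have [K hK] := sum_inv_diverges (maxn k0 4) (Num.max C 1) c0.
exists K; apply: le_trans (_ : Num.max C 1 <= _); first by rewrite le_max lexx.
apply: le_trans hK _.
have [kK|Kk] := leqP (maxn k0 4) K; last first.
  by rewrite big_geq ?(ltnW Kk)//; apply: sumr_ge0 => k _; exact: cubeE_ge0.
rewrite [leRHS](@big_cat_nat _ _ _ (maxn k0 4))//=; last exact: leq_maxl.
rewrite -[leLHS]add0r; apply: lerD.
  by apply: sumr_ge0 => k _; exact: cubeE_ge0.
rewrite big_nat_cond [leRHS]big_nat_cond; apply: ler_sum => k /andP[/andP[hk _] _].
by apply: good_block_prob => //; apply: leq_trans hk; exact: leq_maxr.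
Qed.

(** At the end of a good block of index [k], with [n = (k + 1)!], the walk is at least
    [- k k! + k k! (b - 2) = k k! (b - 3) >= n (b - 4)], where [b] is the deviation at
    precision [e / 3].  For [k] large, [(e / 3) sqrt (2 ln (k + 1)) >= 7] and [b] is at least
    [(1 - e) lil_scale n + 7].  The summand 3 of the statement absorbs the errors made in
    passing from the walk to the permanent. *)
Lemma ae_walk_lower (e : R) : 0 < e <= 1 ->
  {ae P, forall w, forall n0, exists2 n, (n0 <= n)%N &
    n%:R * ((1 - e) * lil_scale R n + 3) <= walk R (bit_prefix xi w (n * n))}.
Proof.
move=> /andP[e0 e1]; pose t := e / 3.
have t01 : 0 < t <= 1 by rewrite /t; lra.
have := ae_good_blocks t01; have := ae_block_start; apply: filterS2 => w [k0 start] good n0.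
have [k1 _ hk1] := exists_ln_ge ((7 / t) ^+ 2) 0.
have [k] := good (maxn (maxn n0 k0) (maxn 4 k1)).
rewrite !geq_max => /andP[/andP[n0k k0k] /andP[k4 k1k]] goodk.
exists (k.+1)`!; first by apply: leq_trans (fact_geq _); apply: leq_trans n0k _.
have startk := start _ k0k.
have /andP[len1 len2] := block_len_bounds k.
pose r := Num.sqrt (2 * ln k.+1%:R) : R.
pose y := Num.sqrt (ln k.+1%:R) : R.
have x0 : 0 <= ln k.+1%:R :> R by rewrite ln_ge0// ler1n.
have t0 : 0 < t by lra.
have ty : 7 / t <= y.
  have h0 : 0 <= 7 / t by rewrite divr_ge0// ltW.
  rewrite /y -[leLHS]ger0_norm// -sqrtr_sqr ler_wsqrtr//.
  by apply: le_trans hk1 _; rewrite ler_ln ?posrE ?ltr0n// ler_nat ltnS.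
have yr : y <= r by rewrite /y /r ler_wsqrtr//; lra.
have rE : r ^+ 2 = 2 * ln k.+1%:R by rewrite sqr_sqrtr// mulr_ge0.
have rk : r ^+ 2 <= 2 * k%:R by rewrite rE ler_pM2l// ln_le_nat.
have scale : lil_scale R k.+1`! <= (1 + t) * r.
  apply: lil_scale_fact_le => //; apply: le_trans ty.
  by rewrite ler_pM2r ?invr_gt0//; lra.
have tr : 7 <= t * r.
  have : 7 <= t * y by rewrite mulrC -ler_pdivrMr.
  nra.
have r7 : 7 <= r by nra.
pose b := block_dev t k; have bE : b = (1 - t) * r by [].
have te : e = 3 * t by rewrite /t; field.
have b4 : (1 - e) * lil_scale R k.+1`! + 3 <= b - 4.
  have : (1 - e) * lil_scale R k.+1`! <= (1 - e) * ((1 + t) * r).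
    by rewrite ler_wpM2l//; lra.
  rewrite bE te; nra.
have bk : b <= k%:R + 4 by rewrite bE; nra.
have b2 : 2 <= b by rewrite bE; nra.
set fk := k`!%:R : R.
have f0 : 0 < fk by rewrite ltr0n fact_gt0.
have hlen : k%:R * fk <= Num.sqrt (block_len k)%:R.
  have kf0 : 0 <= k%:R * fk by rewrite mulr_ge0// ltW.
  rewrite -[leLHS]ger0_norm// -sqrtr_sqr ler_wsqrtr// expr2 -!natrM ler_nat.
  exact: len1.
have hwalk : walk R (bit_prefix xi w (block_end k.+1)) =
    walk R (bit_prefix xi w (block_end k)) +
    walk R (drop (block_end k) (bit_prefix xi w (block_end k.+1))).
  rewrite -walk_cat -(@take_bit_prefix _ _ _ _ xi w _ _ (block_end_homo (leqnSn k))).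
  by rewrite cat_take_drop.
apply: (@le_trans _ _ ((k.+1)`!%:R * (b - 4))).
  by rewrite ler_wpM2l.
rewrite -[((k.+1)`! * (k.+1)`!)%N]/(block_end k.+1) hwalk.
move: startk goodk; rewrite /good_block -/b -/fk => h1 h2.
have h3 : k%:R * fk * (b - 2) <= Num.sqrt (block_len k)%:R * (b - 2).
  by rewrite ler_wpM2r//; lra.
rewrite factS natrM -natr1 -/fk.
have h4 : (k%:R + 1) * fk * (b - 4) <= - (k%:R * fk) + k%:R * fk * (b - 2).
  suff : 0 <= fk * (k%:R + 4 - b) by nra.
  by rewrite mulr_ge0//; lra.
apply: le_trans h4 _; apply: lerD; [exact: ltW h1|exact: le_trans h3 h2].
Qed.

End walk_lil.

(** * Limit superior of the ratio *)

Section limsup.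
Variable R : realType.

Lemma limn_esup_eq1 (u : (\bar R)^nat) :
  (forall e : R, 0 < e <= 1 -> exists n0, forall n, (n0 <= n)%N -> (u n <= (1 + e)%:E)%E) ->
  (forall e : R, 0 < e <= 1 ->
     forall n0, exists2 n, (n0 <= n)%N & ((1 - e)%:E <= u n)%E) ->
  limn_esup u = 1%E.
Proof.
move=> uub ulb; rewrite /limn_esup limf_esupE; apply/eqP; rewrite eq_le; apply/andP; split.
  apply/lee_addgt0Pr => e e0.
  pose e' := Num.min e 1.
  have e'01 : 0 < e' <= 1 by rewrite lt_min e0 ltr01 ge_min lexx orbT.
  have [n0 hn0] := uub _ e'01.
  apply: (@le_trans _ _ (1 + e')%:E); last first.
    by rewrite -EFinD lee_fin lerD2l ge_min lexx.
  apply: (@le_trans _ _ (ereal_sup (u @` [set n | (n0 <= n)%N]))).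
    by apply: ereal_inf_lbound; exists [set n | (n0 <= n)%N] => //; exists n0.
  by apply: ge_ereal_sup => _ [n /= hn <-]; exact: hn0.
apply: le_ereal_inf_tmp => _ [V [n0 _ n0V] <-].
apply/lee_addgt0Pr => e e0.
pose e' := Num.min e 1.
have e'01 : 0 < e' <= 1 by rewrite lt_min e0 ltr01 ge_min lexx orbT.
have [n n0n hn] := ulb _ e'01 n0.
rewrite -leeBlDr//; apply: le_trans (ereal_sup_ubound _); last first.
  by exists n; [exact: n0V|reflexivity].
apply: le_trans hn; rewrite -EFinB lee_fin lerD2l lerN2 ge_min lexx//.
Qed.

Lemma lil_scale_ge (x : R) : exists n0, forall n, (n0 <= n)%N -> x <= lil_scale R n.
Proof.
pose y := Num.max x 1.
have y0 : 0 <= y by rewrite le_max ler01 orbT.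
exists (Num.truncn (expR (expR (y ^+ 2)))).+1 => n hn.
have h1 : expR (expR (y ^+ 2)) <= n%:R.
  by apply: le_trans (ltW (truncnS_gt _)) _; rewrite ler_nat.
have n0 : 0 < n%:R :> R by apply: lt_le_trans h1; exact: expR_gt0.
have h2 : expR (y ^+ 2) <= ln n%:R.
  by rewrite -[leLHS]expRK ler_ln ?posrE ?expR_gt0.
have h3 : y ^+ 2 <= ln (ln n%:R).
  rewrite -[leLHS]expRK ler_ln ?posrE ?expR_gt0//.
  by apply: lt_le_trans h2; exact: expR_gt0.
apply: (@le_trans _ _ y); first by rewrite le_max lexx.
rewrite -[y]ger0_norm// -sqrtr_sqr ler_wsqrtr//.
by have := sqr_ge0 y; lra.
Qed.

End limsup.

Section permanent_lil.
Context (d : measure_display) (T : measurableType d) (R : realType)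
  (P : probability T R) (xi : nat -> nat -> {RV P >-> R}).
Hypothesis xi_indep : mutually_independent (fun ij : nat * nat => xi ij.1 ij.2).
Hypothesis xi_1 : forall i j : nat, P [set w | xi i j w = 1] = (2^-1)%:E.

(** Markov's inequality for the fourth power: the bound [C / n ^ 2] is summable, whereas the
    second moment is only [O (1 / n)]. *)
Lemma ae_chaos_close : {ae P, forall w, exists n0, forall n, (n0 <= n)%N ->
  `|perm_chaos R n (bit_prefix xi w (n * n)) - expo_chaos R n (bit_prefix xi w (n * n))| <= 1}.
Proof.
pose Q n : pred (seq bool) := fun s => 1 < `|perm_chaos R n s - expo_chaos R n s|.
have tail K : \sum_(k < K) cubeE (k.+1 * k.+1) (fun s => (Q k.+1 s)%:R) <=
    (36 * expR 3) ^+ 2 * (1 + 1^-1) :> R.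
  apply: le_trans (ler_wpM2l (sqr_ge0 _) (sum_pseries_le K ltr01)).
  rewrite mulr_sumr; apply: ler_sum => k _.
  have k0 : 0 < k.+1%:R :> R by rewrite ltr0n.
  have -> : expR (- ((1 + 1) * ln k.+1%:R)) = (k.+1%:R ^+ 2)^-1 :> R.
    by rewrite mulrDl mul1r opprD expRD expRN lnK ?posrE// -invfM.
  apply: le_trans (fourth_moment_bound R (ltn0Sn k)).
  apply: cubeE_le => s _; case: (boolP (Q k.+1 s)) => [h|_]; last first.
    by rewrite -[4%N]/(2 * 2)%N exprM sqr_ge0.
  rewrite -[4%N]/(2 * 2)%N exprM exprn_ege1// -real_normK ?num_real//.
  by rewrite exprn_ege1// ltW.
have := borel_cantelli1 xi_indep xi_1 (N := fun k => (k.+1 * k.+1)%N)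
  (Q := fun k => Q k.+1) tail.
apply: filterS => w [k0 hk0]; exists k0.+1 => -[//|n] hn.
by rewrite leNgt; apply: hk0.
Qed.

Lemma minor_perE w n : (forall i j, xi i j w = (bits xi w (i, j))%:R) ->
  minor_per xi n w = perm_chaos R n (bit_prefix xi w (n * n)) * (n`!%:R / 2 ^+ n).
Proof.
move=> wb; rewrite perm_chaosE mulrAC.
have f0 : n`!%:R != 0 :> R by rewrite pnatr_eq0 -lt0n fact_gt0.
have t0 : 2 ^+ n != 0 :> R by rewrite expf_neq0.
have -> : 2 ^+ n / n`!%:R * (n`!%:R / 2 ^+ n) = 1 :> R by field; rewrite f0 t0.
rewrite mul1r /minor_per; congr permanent.
by apply/matrixP => i j; rewrite !mxE wb.
Qed.

Lemma lil_ratio_pos w n : (forall i j, xi i j w = (bits xi w (i, j))%:R) ->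
  0 < lil_scale R n -> 0 < perm_chaos R n (bit_prefix xi w (n * n)) ->
  lil_ratio xi n w = (ln (perm_chaos R n (bit_prefix xi w (n * n))) / lil_scale R n)%:E.
Proof.
move=> wb L0 W0; rewrite /lil_ratio /log_minor_per minor_perE//.
have c0 : 0 < n`!%:R / 2 ^+ n :> R.
  by rewrite divr_gt0 ?exprn_gt0// ltr0n fact_gt0.
rewrite (lne_EFin (mulr_gt0 W0 c0)) lnM ?posrE// EFinD addeK//.
by rewrite -/(lil_scale R n) inver gt_eqF.
Qed.

Lemma lil_ratio_nonpos w n : (forall i j, xi i j w = (bits xi w (i, j))%:R) ->
  0 < lil_scale R n -> perm_chaos R n (bit_prefix xi w (n * n)) <= 0 ->
  lil_ratio xi n w = -oo%E.
Proof.
move=> wb L0 W0; rewrite /lil_ratio /log_minor_per minor_perE// le0_lneNy.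
  rewrite -/(lil_scale R n) inver gt_eqF//.
  by rewrite addNye gt0_mulNye// lte_fin invr_gt0.
by rewrite lee_fin mulr_le0_ge0// divr_ge0// exprn_ge0.
Qed.

Lemma measurable_lne_EFin (f : T -> R) : measurable_fun setT f ->
  measurable_fun setT ((fun w => lne (f w)%:E) : T -> \bar R).
Proof.
move=> mf; rewrite /lne; apply: measurable_fun_ifT.
- exact: measurable_fun_ler.
- exact: measurable_cst.
- by apply/measurable_EFinP; apply: measurableT_comp.
Qed.

Lemma measurable_lil_ratio n : measurable_fun setT (lil_ratio xi n).
Proof.
rewrite /lil_ratio; under eq_fun do rewrite muleC.
apply: measurable_funeM; apply: emeasurable_funB; last exact: measurable_cst.
apply: measurable_lne_EFin; apply: measurable_sum => s.
apply: measurable_prod => i _; under eq_fun do rewrite mxE.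
exact: measurable_funPT.
Qed.

(** Upper half: [W <= G + 1 <= exp a + 1 <= exp (a + 1)] with
    [a = (1 + 1 / (k + 1)) ^ 2 lil_scale n], and 1 is negligible with respect to the scale.
    Lower half: when [S / n >= a + 3] with [a = (1 - e) lil_scale n] nonnegative,
    [W >= G - 1 >= exp (a + 1) - 1 >= exp a]. *)
Lemma limsup_lil_ratio w : (forall i j, xi i j w = (bits xi w (i, j))%:R) ->
  (exists n0, forall n, (n0 <= n)%N ->
    `|perm_chaos R n (bit_prefix xi w (n * n)) - expo_chaos R n (bit_prefix xi w (n * n))| <= 1) ->
  (forall k, exists n0, forall n, (n0 <= n)%N ->
    walk R (bit_prefix xi w (n * n)) <= (1 + k.+1%:R^-1) ^+ 2 * (n%:R * lil_scale R n)) ->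
  (forall k n0, exists2 n, (n0 <= n)%N &
    n%:R * ((1 - k.+1%:R^-1) * lil_scale R n + 3) <= walk R (bit_prefix xi w (n * n))) ->
  limn_esup (fun n => lil_ratio xi n w) = 1%E.
Proof.
move=> wb [n1 close] wub wlb.
have small (e : R) : 0 < e <= 1 -> exists k : nat, (k.+1%:R^-1 : R) <= e.
  move=> /andP[e0 _]; exists (Num.truncn e^-1).
  by rewrite -[leRHS]invrK lef_pV2 ?posrE ?invr_gt0 ?ltr0n// ltW// truncnS_gt.
apply: limn_esup_eq1 => e e01.
- have e401 : 0 < e / 4 <= 1 by lra.
  have [k ke] := small _ e401; have [n2 hn2] := wub k.
  have [n3 hn3] := lil_scale_ge (4 / e).
  exists (maxn 2 (maxn n1 (maxn n2 n3))) => n.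
  rewrite !geq_max => /and4P[n_2 nn1 nn2 nn3].
  have n0 : 0 < n%:R :> R by rewrite ltr0n ltnW.
  have L4 := hn3 _ nn3; have L0 : 0 < lil_scale R n.
    by apply: lt_le_trans L4; rewrite divr_gt0//; lra.
  have [W0|W0] := leP (perm_chaos R n (bit_prefix xi w (n * n))) 0.
    by rewrite lil_ratio_nonpos// leNye.
  rewrite lil_ratio_pos// lee_fin ler_pdivrMr//.
  set W := perm_chaos _ _ _ in W0 *.
  set L := lil_scale R n in L4 L0 *.
  rewrite -[leRHS]expRK ler_ln ?posrE ?expR_gt0//.
  have WG := close _ nn1; rewrite -/W in WG.
  set S := walk R (bit_prefix xi w (n * n)).
  have G : expo_chaos R n (bit_prefix xi w (n * n)) <= expR (S / n%:R).
    by apply: expo_chaos_le; exact: ltnW.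
  pose a := (1 + k.+1%:R^-1) ^+ 2 * L : R.
  have k0 : 0 < k.+1%:R^-1 :> R by rewrite invr_gt0 ltr0n.
  have a0 : 0 <= a by rewrite mulr_ge0 ?sqr_ge0 ?ltW.
  have Sa : S / n%:R <= a.
    rewrite ler_pdivrMr// /a mulrAC -mulrA; exact: hn2.
  have Wa : W <= expR a + 1.
    have Sa' : expR (S / n%:R) <= expR a by rewrite ler_expR.
    move: WG; rewrite ler_norml => /andP[_ WG].
    by move: G Sa' WG; move: (expo_chaos _ _ _) (expR _) (expR _) => x y z; lra.
  apply: (le_trans Wa); apply: (@le_trans _ _ (expR (a + 1))).
    have := expR_ge1Dx (1 : R); have : 1 <= expR a by rewrite -[leLHS]expR0 ler_expR.
    by rewrite expRD; nra.
  rewrite ler_expR.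
  have L1 : 1 <= e / 4 * L.
    by move: L4; rewrite ler_pdivrMr ?(andP e01).1//; lra.
  have h : (1 + k.+1%:R^-1) ^+ 2 <= 1 + 3 / 4 * e.
    by move: ke k0 e01 => {}; move: (k.+1%:R^-1) => x xe x0 /andP[_ e1]; nra.
  have := ler_wpM2r (ltW L0) h; rewrite -/a; lra.
- move=> n0; have [k ke] := small _ e01.
  have [n3 hn3] := lil_scale_ge (1 : R).
  have [n] := wlb k (maxn (maxn 2 n0) (maxn n1 n3)).
  rewrite !geq_max => /andP[/andP[n_2 nn0] /andP[nn1 nn3]] hS; exists n => //.
  have np : 0 < n%:R :> R by rewrite ltr0n ltnW.
  have L1 := hn3 _ nn3; have L0 : 0 < lil_scale R n by apply: lt_le_trans L1.
  set L := lil_scale R n in hS L1 L0 *.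
  have WG := close _ nn1; set W := perm_chaos _ _ _ in WG *.
  set S := walk R (bit_prefix xi w (n * n)) in hS.
  have G : expR (S / n%:R - 2) <= expo_chaos R n (bit_prefix xi w (n * n)).
    by apply: expo_chaos_ge => //; exact: size_bit_prefix.
  pose a := (1 - e) * L.
  have a0 : 0 <= a by rewrite mulr_ge0 ?(ltW L0)//; lra.
  have Sa : a + 1 <= S / n%:R - 2.
    rewrite lerBrDr ler_pdivlMr// mulrC; apply: le_trans hS.
    rewrite ler_pM2l// /a; move: ke; move: (_^-1) => x ke; nra.
  have Wa : expR a <= W.
    have Sa' : expR (a + 1) <= expR (S / n%:R - 2) by rewrite ler_expR.
    have h1 : 1 <= expR a by rewrite -[leLHS]expR0 ler_expR.
    have h2 := expR_ge1Dx (1 : R); move: Sa'; rewrite expRD.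
    move: WG; rewrite ler_norml => /andP[WG _].
    move: G WG h1 h2; move: (expo_chaos _ _ _) (expR (_ - 2)) (expR a) (expR 1) => x y z t.
    nra.
  have W0 : 0 < W by apply: lt_le_trans Wa; exact: expR_gt0.
  rewrite lil_ratio_pos// lee_fin ler_pdivlMr// -/W -/L -/a.
  by rewrite -[leLHS]expRK ler_ln ?posrE ?expR_gt0.
Qed.

End permanent_lil.

Theorem theorem1p1 (d : measure_display) (T : measurableType d) (R : realType)
    (P : probability T R) (xi : nat -> nat -> {RV P >-> R})
    (xi_indep : mutually_independent (fun ij : nat * nat => xi ij.1 ij.2))
    (xi_0 : forall i j : nat, P [set w | xi i j w = 0] = (2^-1)%:E)
    (xi_1 : forall i j : nat, P [set w | xi i j w = 1] = (2^-1)%:E) :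
  P [set w | limn_esup (fun n : nat => lil_ratio xi n w) = 1%E] = 1%E.
Proof.
set E := [set w | _].
have mE : measurable E.
  have m := measurable_fun_limn_esup (measurable_lil_ratio xi).
  have := m measurableT [set 1%E] (emeasurable_set1 _).
  by rewrite setTI.
have aeE : {ae P, forall w, E w}.
  have k01 k : 0 < (k.+1%:R^-1 : R) <= 1.
    by apply/andP; split; rewrite ?invr_gt0 ?ltr0n// invf_le1 ?ltr0n// ler1n.
  have h1 := ae_xi_bits xi_0 xi_1.
  have h2 := ae_chaos_close xi_indep xi_1.
  have h3 : {ae P, forall w, forall k : nat, exists n0, forall n, (n0 <= n)%N ->
      walk R (bit_prefix xi w (n * n)) <= (1 + k.+1%:R^-1) ^+ 2 * (n%:R * lil_scale R n)}.
    apply: ae_foralln => k; apply: (ae_walk_upper xi_indep xi_1).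
    by rewrite invr_gt0 ltr0n.
  have h4 : {ae P, forall w, forall k : nat, forall n0, exists2 n, (n0 <= n)%N &
      n%:R * ((1 - k.+1%:R^-1) * lil_scale R n + 3) <= walk R (bit_prefix xi w (n * n))}.
    by apply: ae_foralln => k; apply: (ae_walk_lower xi_indep xi_1).
  apply: filterS (filterI (filterI h1 h2) (filterI h3 h4)) => w [[b c] [u l]].
  exact: limsup_lil_ratio.
have EC : P (~` E) = 0%E by apply/negligibleP => //; exact: measurableC.
by rewrite -[E]setCK probability_setC ?EC ?sube0//; exact: measurableC.
Qed.
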